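(* Let $k\ge 2$ and let $R=\mathbb{C}[x,y]/(x^k)$ be $\mathbb{Z}$-graded with $\deg x=1$, $\deg y=-1$. There is a bijection between the set of isomorphism classes of generically free modules of rank $1$ in $\mathrm{MCM}_{\mathbb{Z}}R$ and the set of Plücker coordinates $p_{\underline{\ell}}$ ($\underline{\ell}\subseteq\mathbb{Z}$, $|\underline{\ell}|=k$) of $\mathcal{A}_k$. The bijection is given by the mutually inverse maps $$I\mapsto p_{\underline{\ell}(I)},\qquad p_{\underline{\ell}}\mapsto I(\underline{\ell}).$$
   Context: Gradings: for a graded module $M$, $M(j)$ is the shift $M(j)_i=M_{i+j}$; morphisms of graded modules are homogeneous of degree $0$, and isomorphism means isomorphism of graded modules. $\mathrm{gr}R$ is the category of finitely generated $\mathbb{Z}$-graded $R$-modules. $\mathrm{MCM}_{\mathbb{Z}}R$ is the full subcategory of $\mathrm{gr}R$ of maximal Cohen--Macaulay modules, i.e. those $M$ with $\mathrm{Ext}^i_R(M,R)=0$ for all $i>0$ (equivalently, since $R$ is Gorenstein, $\mathrm{depth}(M_{\mathfrak p})=\dim R_{\mathfrak p}$ for all primes $\mathfrak p$ in the support of $M$). Let $\mathcal{F}=R_y=\mathbb{C}[x,y^{\pm 1}]/(x^k)$, with induced grading. $M\in\mathrm{gr}R$ is generically free of rank $n$ if $M\otimes_R\mathcal{F}$ is a graded free $\mathcal{F}$-module of rank $n$. $\mathcal{A}_k=\mathbb{C}[p_{\underline{\ell}}\mid \underline{\ell}\subseteq\mathbb{Z},\ |\underline{\ell}|=k]/\mathcal{I}_P$,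 where $\mathcal{I}_P$ is generated by the Plücker relations $\sum_{l=0}^{k}(-1)^l p_{J'\cup\{j_l\}}\,p_{J\setminus\{j_l\}}$ for $J=\{j_0<\dots<j_k\}$, $J'\subseteq\mathbb{Z}$ with $|J|=k+1$, $|J'|=k-1$ (with the usual convention that $p_{J'\cup\{j\}}$ is antisymmetric in the ordered list consisting of the elements of $J'$ in increasing order together with $j$, hence $0$ if $j\in J'$). The classes $p_{\underline{\ell}}$ are the Plücker coordinates. A $k$-subset $\underline{\ell}\subseteq\mathbb{Z}$ is viewed as a strictly increasing tuple $(\ell_1<\dots<\ell_k)$. Every generically free module of rank $1$ in $\mathrm{MCM}_{\mathbb{Z}}R$ is isomorphic to some $I=(x^{k-1},x^{k-2}y^{i_1},x^{k-3}y^{i_2},\dots,xy^{i_{k-2}},y^{i_{k-1}})(i_k)$ with $0\le i_1\le\dots\le i_{k-1}$ and $i_k\in\mathbb{Z}$. For such $I$, $\underline{\ell}(I)$ is the $k$-subset $$\underline{\ell}(I)=(-i_k-i_{k-1},\,-i_k-i_{k-2}+1,\,\dots,\,-i_k-i_1+k-2,\,-i_k+k-1).$$ Conversely, for a $k$-subset $\underline{\ell}=(\ell_1,\dots,\ell_k)$, $$I(\underline{\ell})=(x^{k-1},x^{k-2}y^{i_1},\dots,xy^{i_{k-2}},y^{i_{k-1}})(i_k),\quad i_k=k-1-\ell_k,\ \ i_{k-p}=\ell_k-\ell_p-(k-p)\ (1\le p\le k-1).$$ *)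

(* Defs.v *)
From HB Require Import structures.
From mathcomp Require Import all_boot all_order all_algebra.
From mathcomp Require Import finmap.
From mathcomp Require Import boolp reals complex.
From mathcomp.multinomials Require Import monalg.
From mathcomp Require Import zify.

Set Implicit Arguments.
Unset Strict Implicit.
Unset Printing Implicit Defensive.

Import Order.TTheory GRing.Theory Num.Theory.
Local Open Scope ring_scope.

Definition gen_ideal (A : comNzRingType) (G : A -> Prop) : pred A :=
  fun u => `[< exists2 s : seq (A * A),
                 (forall p, p \in s -> G p.2) & u = \sum_(p <- s) p.1 * p.2 >].

Section GenIdeal.
Variables (A : comNzRingType) (G : A -> Prop).

Lemma gen_ideal_mem c g : G g -> c * g \in gen_ideal G.
Proof.
move=> Gg; apply/asboolP; exists [:: (c, g)]; last by rewrite big_seq1.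
by move=> p; rewrite inE => /eqP ->.
Qed.

Lemma gen_ideal_ind (P : A -> Prop) :
    P 0 -> (forall c g u, G g -> P u -> P (c * g + u)) ->
  forall u, u \in gen_ideal G -> P u.
Proof.
move=> P0 PD u /asboolP[s Gs ->]; elim: s Gs => [|[c g] s IHs] Gs.
  by rewrite big_nil.
rewrite big_cons; apply: PD; first by apply: (Gs (c, g)); rewrite mem_head.
by apply: IHs => p ps; apply: Gs; rewrite in_cons ps orbT.
Qed.

Lemma gen_ideal0 : 0 \in gen_ideal G.
Proof. by apply/asboolP; exists [::] => //; rewrite big_nil. Qed.

Lemma gen_idealD u v :
  u \in gen_ideal G -> v \in gen_ideal G -> u + v \in gen_ideal G.
Proof.
move=> /asboolP[s Gs ->] /asboolP[t Gt ->]; apply/asboolP.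
exists (s ++ t); last by rewrite big_cat.
by move=> p; rewrite mem_cat => /orP[/Gs|/Gt].
Qed.

Lemma gen_idealM a u : u \in gen_ideal G -> a * u \in gen_ideal G.
Proof.
move: u; apply: gen_ideal_ind => [|c g u Gg au].
  by rewrite mulr0 gen_ideal0.
by rewrite mulrDr mulrA; apply: gen_idealD => //; apply: gen_ideal_mem.
Qed.

Lemma gen_ideal_submod : GRing.submod_closed (gen_ideal G : {pred A^o}).
Proof.
split=> [|a u v Gu Gv]; first exact: gen_ideal0.
by apply: gen_idealD => //; apply: gen_idealM.
Qed.

HB.instance Definition _ :=
  GRing.isSubmodClosed.Build A A^o (gen_ideal G : {pred A^o}) gen_ideal_submod.

Record ideal_mod := IdealMod {
  ideal_val :> A^o;
  _ : ideal_val \in (gen_ideal G : {pred A^o}) }.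

HB.instance Definition _ := [isSub for ideal_val].
HB.instance Definition _ := [Choice of ideal_mod by <:].
HB.instance Definition _ := [SubChoice_isSubLmodule of ideal_mod by <:].

End GenIdeal.

(* R = C[x,y]/(x^k) with deg x = 1 and deg y = -1: the outer variable of
   [{poly {poly C}}] is x, the inner one is y.  For k = 0 the library replaces
   the modulus x^0 by x. *)
Definition ringR (C : fieldType) (k : nat) : Type :=
  {poly %/ ('X^k : {poly {poly C}})}.
HB.instance Definition _ C k := GRing.ComNzRing.on (ringR C k).

Definition xR (C : fieldType) (k : nat) : ringR C k := in_qpoly 'X^k 'X.
Definition yR (C : fieldType) (k : nat) : ringR C k := in_qpoly 'X^k ('X%:P).

(* Elements of [{poly %/ 'X^k}] are reduced representatives, so the homogeneous
   pieces can be read off from the coefficients of the monomials x^a y^b. *)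
Definition partR (C : fieldType) (k : nat) (d : int) (r : ringR C k) : Prop :=
  forall a b : nat, (r : {poly {poly C}})`_a`_b != 0 -> a%:Z - b%:Z = d.

Section RingR.
Variables (C : fieldType) (k : nat).
Local Notation R := (ringR C k).
Implicit Types (r : R) (p q : {poly {poly C}}).

Let cf r (a b : nat) := (r : {poly {poly C}})`_a`_b.

Lemma coef_in_qpolyXn p a :
  (in_qpoly 'X^k p : {poly {poly C}})`_a = if (a < k.-1.+1)%N then p`_a else 0.
Proof.
by rewrite /= mk_monic_Xn -Pdiv.RingMonic.take_poly_rmodp coef_take_poly.
Qed.

Lemma coef_mulR r s a :
  (r * s : {poly {poly C}})`_a =
  if (a < k.-1.+1)%N then ((r : {poly {poly C}}) * (s : {poly {poly C}}))`_a
  else 0.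
Proof. exact: coef_in_qpolyXn. Qed.

Lemma partR0 d : partR d (0 : R).
Proof. by move=> a b; rewrite /= !coef0 eqxx. Qed.

Lemma partRD d r s : partR d r -> partR d s -> partR d (r + s).
Proof.
move=> Hr Hs a b; rewrite /= coefD coefD => nz.
have [r0|/Hr//] := eqVneq ((r : {poly {poly C}})`_a`_b) 0.
by apply: Hs; rewrite r0 add0r in nz.
Qed.

Lemma partRM d e r s : partR d r -> partR e s -> partR (d + e) (r * s).
Proof.
move=> Hr Hs a b; rewrite coef_mulR; case: ifP => _; last by rewrite coef0 eqxx.
rewrite coefM coef_sum => nz.
have [i /= nzi] : exists i : 'I_a.+1,
    ((r : {poly {poly C}})`_i * (s : {poly {poly C}})`_(a - i))`_b != 0.
  apply/existsP; apply: contra_neqT nz => /existsPn nz.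
  by apply: big1 => i _; apply/eqP; move: (nz i); rewrite negbK.
rewrite coefM in nzi.
have [j /=] : exists j : 'I_b.+1,
    (r : {poly {poly C}})`_i`_j * (s : {poly {poly C}})`_(a - i)`_(b - j) != 0.
  apply/existsP; apply: contra_neqT nzi => /existsPn nz'.
  by apply: big1 => j _; apply/eqP; move: (nz' j); rewrite negbK.
rewrite mulf_eq0 negb_or => /andP[/Hr <- /Hs <-].
have := ltn_ord i; have := ltn_ord j; rewrite !ltnS => ja ib.
by rewrite -!subzn // addrACA -opprD !subrKC.
Qed.

Lemma partR_decomp r : exists l : seq R,
  (forall s, s \in l -> exists d, partR d s) /\ r = \sum_(s <- l) s.
Proof.
pose m a b : R := in_qpoly 'X^k (('X^b * (cf r a b)%:P)%:P * 'X^a).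
exists (flatten [seq [seq m a b | b <- iota 0 (size (r : {poly {poly C}})`_a)]
          | a <- iota 0 k.-1.+1]); split.
  move=> s /flattenP[_ /mapP[a _ ->] /mapP[b _ ->]]; exists (a%:Z - b%:Z).
  move=> a' b'; rewrite coef_in_qpolyXn; case: ifP; last by rewrite coef0 eqxx.
  rewrite coefCM coefXn; case: (a' =P a) => [-> _|_]; last first.
    by rewrite mulr0 coef0 eqxx.
  by rewrite mulr1 coefMC coefXn; case: (b' =P b) => [->|_]; rewrite ?mul0r ?eqxx.
have sr : (size (r : {poly {poly C}}) <= k.-1.+1)%N.
  by apply: leq_trans (size_npoly r) _; rewrite mk_monic_Xn size_polyXn.
rewrite big_flatten big_map; apply: val_inj; apply/polyP => i.
rewrite raddf_sum coef_sum.
have E a : \sum_(j <- [seq m a b | b <- iota 0 (size (r : {poly {poly C}})`_a)]) j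
    = in_qpoly 'X^k (((r : {poly {poly C}})`_a)%:P * 'X^a).
  rewrite big_map /m -raddf_sum -mulr_suml -raddf_sum; congr (in_qpoly _ (_%:P * _)).
  rewrite -[RHS]coefK poly_def -(big_mkord xpredT
    (fun b => (r : {poly {poly C}})`_a`_b *: 'X^b)) /index_iota subn0.
  by apply: eq_bigr => b _; rewrite mulrC mul_polyC.
rewrite (eq_bigr (fun a => if i == a then
    (if (i < k.-1.+1)%N then (r : {poly {poly C}})`_i else 0) else 0)).
  have [ik|ik] := ltnP i k.-1.+1.
    rewrite (bigD1_seq i) ?iota_uniq ?mem_iota //= eqxx big1 ?addr0 // => a.
    by rewrite eq_sym => /negbTE ->.
  by rewrite nth_default ?(leq_trans sr) // big1 // => a _; case: ifP.
move=> a _; rewrite E coef_in_qpolyXn coefCM coefXn.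
by case: eqP => [->|_]; rewrite ?mulr1 ?mulr0 ?if_same.
Qed.

Lemma partR_indep (s : seq int) (c : int -> R) :
    uniq s -> (forall d, partR d (c d)) -> \sum_(d <- s) c d = 0 ->
  forall d, d \in s -> c d = 0.
Proof.
move=> us Hc s0 d ds; apply: val_inj; apply/polyP => a; apply/polyP => b /=.
rewrite !coef0; apply/eqP; apply: contraT => nz; have dE := Hc d a b nz.
case/eqP: nz; have := congr1 (fun r : R => cf r a b) s0.
rewrite /cf /= raddf_sum !coef_sum !coef0 (bigD1_seq d) //= big1 ?addr0 //.
move=> e ed; apply/eqP; apply: contraT => /Hc eE.
by rewrite -eE dE eqxx in ed.
Qed.

Lemma partR_x : partR 1 (xR C k).
Proof.
move=> a b; rewrite coef_in_qpolyXn; case: ifP; last by rewrite coef0 eqxx.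
rewrite coefX; case: (a =P _) => [-> _|_]; last by rewrite coef0 eqxx.
by rewrite coef1; case: (b =P _) => [->|]; rewrite ?eqxx ?subr0.
Qed.

Lemma partR_y : partR (- 1) (yR C k).
Proof.
move=> a b; rewrite coef_in_qpolyXn; case: ifP; last by rewrite coef0 eqxx.
rewrite coefC; case: (a =P _) => [-> _|_]; last by rewrite coef0 eqxx.
by rewrite coefX; case: (b =P _) => [->|]; rewrite ?eqxx ?sub0r.
Qed.

Lemma partR1 : partR 0 (1 : R).
Proof.
rewrite -[1](in_qpoly1 ('X^k : {poly {poly C}})).
move=> a b; rewrite coef_in_qpolyXn; case: ifP; last by rewrite coef0 eqxx.
rewrite coef1; case: (a =P _) => [-> _|_]; last by rewrite coef0 eqxx.
by rewrite coef1; case: (b =P _) => [->|]; rewrite ?eqxx ?subr0.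
Qed.

Lemma partRX d r n : partR d r -> partR (d *+ n) (r ^+ n).
Proof.
move=> Hr; elim: n => [|n IHn]; first exact: partR1.
by rewrite mulrS exprS; apply: partRM.
Qed.

End RingR.

(* The last two conditions say that M is the direct sum of its pieces M_d. *)
Record is_grading (C : fieldType) (k : nat) (M : lmodType (ringR C k))
    (part : int -> M -> Prop) : Prop := IsGrading {
  grading0 : forall d, part d 0;
  gradingD : forall d m n, part d m -> part d n -> part d (m + n);
  gradingZ : forall i j (r : ringR C k) m,
    partR i r -> part j m -> part (i + j) (r *: m);
  grading_decomp : forall m, exists l : seq M,
    (forall n, n \in l -> exists d, part d n) /\ m = \sum_(n <- l) n;
  grading_indep : forall (s : seq int) (c : int -> M),
    uniq s -> (forall d, part d (c d)) -> \sum_(d <- s) c d = 0 ->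
    forall d, d \in s -> c d = 0 }.

Record grMod (C : fieldType) (k : nat) := GrMod {
  grcar :> lmodType (ringR C k);
  grpart : int -> grcar -> Prop;
  grP : is_grading grpart }.
Arguments grpart {C k} g d m.
Arguments grP {C k} g.

Definition gr_iso (C : fieldType) (k : nat) (M N : grMod C k) : Prop :=
  exists f : {linear M -> N},
    bijective f /\ forall d m, grpart M d m <-> grpart N d (f m).

Definition fin_gen (A : pzRingType) (M : lmodType A) : Prop :=
  exists s : seq M, forall m,
    exists c : 'I_(size s) -> A, m = \sum_(i < size s) c i *: s`_i.

Section Shift.
Variables (C : fieldType) (k : nat) (M : grMod C k) (j : int).

Lemma shift_subproof : is_grading (fun d (m : M) => grpart M (d + j) m).
Proof.
split=> [d|d m n|i e r m Hr Hm|m|s c us Hc s0 d ds].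
- exact: (grading0 (grP M)).
- exact: (gradingD (grP M)).
- by rewrite -addrA; apply: (gradingZ (grP M)).
- have [l [Hl ->]] := grading_decomp (grP M) m; exists l; split=> // n /Hl[d Hd].
  by exists (d - j); rewrite subrK.
have /= := @grading_indep _ _ _ _ (grP M) (map (+%R^~ j) s) (fun e => c (e - j)).
have shI : injective (+%R^~ j : int -> int) by apply: addIr.
move=> /(_ _ _ _ (d + j)); rewrite addrK; apply.
- by rewrite map_inj_uniq.
- by move=> e; have := Hc (e - j); rewrite subrK.
- by rewrite big_map -[RHS]s0; apply: eq_bigr => e _; rewrite addrK.
- by apply: (map_f (+%R^~ j)).
Qed.

Definition shift : grMod C k := GrMod shift_subproof.

End Shift.

Section HomogeneousIdeal.
Variables (C : fieldType) (k : nat) (G : ringR C k -> Prop).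
Hypothesis homG : forall g, G g -> exists d, partR d g.

Lemma hideal_subproof :
  is_grading (fun d (u : ideal_mod G) => partR d (ideal_val u : ringR C k)).
Proof.
split=> [d|d m n|i e r m Hr Hm|m|s c us Hc s0 d ds].
- exact: partR0.
- exact: partRD.
- exact: partRM.
- pose Q (u : ringR C k) := exists l : seq (ideal_mod G),
    (forall n, n \in l -> exists d, partR d (ideal_val n : ringR C k)) /\
    u = \sum_(n <- l) (ideal_val n : ringR C k).
  have: Q (ideal_val m).
    have QD u v : Q u -> Q v -> Q (u + v).
      move=> [l [Hl ->]] [l' [Hl' ->]]; exists (l ++ l'); rewrite big_cat.
      by split=> // n; rewrite mem_cat => /orP[/Hl|/Hl'].
    have Q0 : Q 0 by exists [::]; rewrite big_nil.
    case: m => m mG /=; move: m mG; apply: gen_ideal_ind => // a g u Gg Qu.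
    apply: (QD _ _ _ Qu); have [l [Hl ->]] := partR_decomp a.
    elim: l Hl => [|s l IHl] Hl; first by rewrite big_nil mul0r.
    rewrite big_cons mulrDl; apply: QD; last first.
      by apply: IHl => n nl; apply: Hl; rewrite in_cons nl orbT.
    exists [:: IdealMod (gen_ideal_mem s Gg)]; rewrite big_seq1; split=> // n.
    rewrite inE => /eqP -> /=.
    have [[d Hd] [e He]] := (Hl s (mem_head _ _), homG Gg).
    by exists (d + e); apply: partRM.
  move=> [l [Hl mE]]; exists l; split=> //; apply: val_inj.
  by rewrite raddf_sum.
- apply: val_inj; apply: (@partR_indep _ _ s (fun e => ideal_val (c e))) => //.
  by rewrite -(raddf_sum val) s0.
Qed.

Definition hideal : grMod C k := GrMod hideal_subproof.

End HomogeneousIdeal.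

Section Ext.
Variable A : pzRingType.

Definition projective (P : lmodType A) : Prop :=
  forall (U V : lmodType A) (f : {linear U -> V}) (g : {linear P -> V}),
    (forall v, exists u, f u = v) ->
    exists h : {linear P -> U}, forall p, f (h p) = g p.

Record proj_resolution (M : lmodType A) := ProjResolution {
  res :> nat -> lmodType A;
  res_d : forall n, {linear res n.+1 -> res n};
  res_aug : {linear res 0%N -> M};
  res_proj : forall n, projective (res n);
  res_surj : forall m, exists p, res_aug p = m;
  res_exact0 : forall p, res_aug p = 0 <-> exists q, res_d 0%N q = p;
  res_exact : forall n p, res_d n p = 0 <-> exists q, res_d n.+1 q = p }.

Definition ext_cocycle (M N : lmodType A) (P : proj_resolution M) i
    (f : {linear P i -> N}) : Prop :=
  forall q, f (res_d P i q) = 0.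

Definition ext_coboundary (M N : lmodType A) (P : proj_resolution M) i :
    {linear P i -> N} -> Prop :=
  match i with
  | 0%N => fun f => forall p, f p = 0
  | j.+1 => fun f => exists g : {linear P j -> N}, forall p, f p = g (res_d P j p)
  end.

(* Ext^i(M,N) = H^i(Hom(P,N)) for a projective resolution P of M; every M has
   one, and up to isomorphism the cohomology does not depend on its choice. *)
Definition ext_zero i (M N : lmodType A) : Prop :=
  exists P : proj_resolution M,
    forall f : {linear P i -> N}, ext_cocycle f -> ext_coboundary f.

End Ext.

Definition mcm (C : fieldType) (k : nat) (M : lmodType (ringR C k)) : Prop :=
  forall i, (0 < i)%N -> ext_zero i M (ringR C k)^o.

(* C[y^{+-1}], as the subring of C(y) of fractions p(y)/y^n. *)
Definition laurent_pred (C : fieldType) : pred {fraction {poly C}} :=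
  fun u => `[< exists (p : {poly C}) (n : nat),
                 u = tofrac p / tofrac 'X ^+ n >].

Section Laurent.
Variable C : fieldType.

Lemma fracX_neq0 n : tofrac ('X : {poly C}) ^+ n != 0.
Proof. by rewrite expf_neq0 // tofrac_eq0 polyX_eq0. Qed.

Lemma laurent_subring : GRing.subring_closed (@laurent_pred C).
Proof.
split=> [|u v /asboolP[p [n ->]] /asboolP[q [m ->]]
        |u v /asboolP[p [n ->]] /asboolP[q [m ->]]]; apply/asboolP.
- by exists 1, 0%N; rewrite tofrac1 expr0 divr1.
- exists (p * 'X^m - q * 'X^n), (n + m)%N.
  by rewrite tofracB !tofracM !tofracXn -mulNr addf_div ?fracX_neq0 // exprD mulNr.
- by exists (p * q), (n + m)%N; rewrite tofracM exprD mulf_div.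
Qed.

HB.instance Definition _ := GRing.isSubringClosed.Build {fraction {poly C}}
  (@laurent_pred C) laurent_subring.

Record laurent := Laurent {
  laurent_val :> {fraction {poly C}};
  _ : laurent_val \in @laurent_pred C }.

HB.instance Definition _ := [isSub for laurent_val].
HB.instance Definition _ := [Choice of laurent by <:].
HB.instance Definition _ := [SubChoice_isSubComNzRing of laurent by <:].

Lemma laurent_of_poly_subproof (p : {poly C}) : tofrac p \in @laurent_pred C.
Proof. by apply/asboolP; exists p, 0%N; rewrite expr0 divr1. Qed.

Definition laurent_of_poly (p : {poly C}) : laurent :=
  Laurent (laurent_of_poly_subproof p).

End Laurent.

(* F = R_y = C[x,y^{+-1}]/(x^k). *)
Definition ringF (C : fieldType) (k : nat) : Type :=
  {poly %/ ('X^k : {poly laurent C})}.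
HB.instance Definition _ C k := GRing.ComNzRing.on (ringF C k).

(* Homogeneous of degree d: the coefficient of x^a is a multiple of y^(a-d). *)
Definition partF (C : fieldType) (k : nat) (d : int) (f : ringF C k) : Prop :=
  forall a : nat, exists c : C,
    laurent_val (f : {poly laurent C})`_a =
    tofrac c%:P * tofrac 'X ^ (a%:Z - d).

Definition loc (C : fieldType) (k : nat) (r : ringR C k) : ringF C k :=
  in_qpoly 'X^k (map_poly (@laurent_of_poly C) r).

Section Tensor.
Variables (C : fieldType) (k : nat) (M : lmodType (ringR C k)).
Local Notation F := (ringF C k).

Record balanced (U : zmodType) (b : M -> F -> U) : Prop := Balanced {
  balancedDl : forall m n f, b (m + n) f = b m f + b n f;
  balancedDr : forall m f g, b m (f + g) = b m f + b m g;
  balancedZ : forall (r : ringR C k) m f, b (r *: m) f = b m (loc r * f) }.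

(* (T, t) is the tensor product of M and F over R, with its F-module structure. *)
Record is_tensor (T : lmodType F) (t : M -> F -> T) : Prop := IsTensor {
  tensor_balanced : balanced t;
  tensor_scale : forall m f g, t m (f * g) = f *: t m g;
  tensor_ex : forall (U : zmodType) (b : M -> F -> U), balanced b ->
    exists h : {additive T -> U}, forall m f, h (t m f) = b m f;
  tensor_uniq : forall (U : zmodType) (h h' : {additive T -> U}),
    (forall m f, h (t m f) = h' (t m f)) -> forall z, h z = h' z }.

End Tensor.

(* M (x) F is the graded module F(j_1) (+) ... (+) F(j_n); its piece of degree d
   is spanned by the m (x) f with m and f homogeneous and deg m + deg f = d. *)
Definition gen_free (C : fieldType) (k n : nat) (M : grMod C k) : Prop :=
  exists (j : 'I_n -> int) (t : M -> ringF C k -> 'rV[ringF C k]_n),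
    is_tensor t /\
    forall d e m f, grpart M d m -> partF e f ->
      forall s, partF (d + e + j s) (t m f 0 s).

Definition mcm_rank1 (C : fieldType) (k : nat) (M : grMod C k) : Prop :=
  [/\ fin_gen M, mcm M & gen_free 1 M].

Definition iso_classes (C : fieldType) (k : nat) : Type :=
  {c : grMod C k -> Prop | exists2 M, mcm_rank1 M & c = gr_iso M}.

Definition iso_class (C : fieldType) (k : nat) (M : grMod C k)
    (MP : mcm_rank1 M) : iso_classes C k :=
  exist _ (gr_iso M) (ex_intro2 _ _ M MP erefl).

(* [idx_i I q] is i_q for 1 <= q <= k-1, extended by i_0 = 0, and [idx_tw I] is
   the twist i_k. *)
Record idx (k : nat) := Idx {
  idx_t : (k.-1).-tuple nat;
  idx_sorted : sorted leq idx_t;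
  idx_tw : int }.

Definition idx_i k (I : idx k) (q : nat) : nat := nth 0%N (0%N :: idx_t I) q.

Definition idx_gens (C : fieldType) k (I : idx k) (g : ringR C k) : Prop :=
  exists2 q, (q < k)%N & g = xR C k ^+ (k.-1 - q) * yR C k ^+ idx_i I q.

Lemma idx_gens_hom (C : fieldType) k (I : idx k) (g : ringR C k) :
  idx_gens I g -> exists d, partR d g.
Proof.
by move=> [q _ ->]; eexists; apply: partRM; apply: partRX;
   [apply: partR_x | apply: partR_y].
Qed.

Definition idealI (C : fieldType) k (I : idx k) : grMod C k :=
  shift (hideal (@idx_gens_hom C k I)) (idx_tw I).

Definition ksubset (k : nat) : Type := {l : {fset int} | #|` l| == k}.
HB.instance Definition _ k := Choice.on (ksubset k).

Definition fsort (l : {fset int}) : seq int := sort <=%R (enum_fset l).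

(* l_p, for 1 <= p <= k. *)
Definition entry (l : {fset int}) (p : nat) : int := nth 0 (fsort l) p.-1.

Definition ell_entry k (I : idx k) (p : nat) : int :=
  - idx_tw I - (idx_i I (k - p))%:Z + p%:Z - 1.

Section EllAndBack.
Variable k : nat.

Lemma idx_i_mono (I : idx k) q q' :
  (q <= q' < k)%N -> (idx_i I q <= idx_i I q')%N.
Proof.
move=> /andP[qq' q'k].
have k0 : (0 < k)%N by apply: leq_ltn_trans q'k.
have S : sorted leq (0%N :: idx_t I).
  by rewrite /= path_min_sorted ?idx_sorted //; apply/allP.
apply: (sorted_leq_nth leq_trans leqnn _ S) => //.
  by rewrite inE /= size_tuple prednK // (leq_ltn_trans qq').
by rewrite inE /= size_tuple prednK.
Qed.

Lemma ell_entry_lt (I : idx k) p p' :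
  (0 < p)%N -> (p < p' <= k)%N -> ell_entry I p < ell_entry I p'.
Proof.
move=> p0 /andP[pp' p'k]; rewrite /ell_entry.
have := @idx_i_mono I (k - p') (k - p).
have -> : (k - p' <= k - p < k)%N.
  by rewrite leq_sub2l ?(ltnW pp') //= -subn_gt0 subKn // ltnW ?(leq_trans pp').
move=> /(_ isT) H.
by rewrite ltrD2r ler_ltD ?ltz_nat // lerD2l lerN2 lez_nat.
Qed.

Definition ell_fset (I : idx k) : {fset int} :=
  [fset ell_entry I p | p in iota 1 k]%fset.

Lemma ell_card (I : idx k) : #|` ell_fset I| == k.
Proof.
rewrite /ell_fset card_in_imfset /=.
  by rewrite undup_id ?iota_uniq // size_iota.
move=> p p'; rewrite !mem_iota add1n !ltnS => /andP[p0 pk] /andP[p'0 p'k] E.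
have [lt|lt|//] := ltngtP p p'.
  by have := @ell_entry_lt I p p' p0; rewrite lt p'k E ltxx => /(_ isT).
by have := @ell_entry_lt I p' p p'0; rewrite lt pk E ltxx => /(_ isT).
Qed.

Definition ell (I : idx k) : ksubset k := exist _ (ell_fset I) (ell_card I).

(* i_q = l_k - l_{k-q} - q, which is nonnegative as the l_p strictly increase. *)
Definition back_i (l : ksubset k) (q : nat) : int :=
  entry (val l) k - entry (val l) (k - q) - q%:Z.

Lemma back_i_step (l : ksubset k) q : (q.+1 < k)%N ->
  back_i l q <= back_i l q.+1.
Proof.
move=> qk; rewrite /back_i /entry.
have sz : size (fsort (val l)) = k.
  by rewrite size_sort; apply/eqP; apply: (valP l).
have S : sorted <%R (fsort (val l)).
  by rewrite lt_sorted_uniq_le sort_uniq fset_uniq sort_le_sorted.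
have : nth 0 (fsort (val l)) (k - q.+1).-1 < nth 0 (fsort (val l)) (k - q).-1.
  by apply: (sorted_ltn_nth lt_trans 0 S); rewrite ?inE ?sz; lia.
lia.
Qed.

Lemma back_i0 (l : ksubset k) : back_i l 0 = 0.
Proof. by rewrite /back_i subn0 subrr subr0. Qed.

Lemma back_i_ge0 (l : ksubset k) q : (q < k)%N -> 0 <= back_i l q.
Proof.
elim: q => [|q IHq] qk; first by rewrite back_i0.
exact: le_trans (IHq (ltnW qk)) (back_i_step l qk).
Qed.

Lemma back_sorted (l : ksubset k) :
  sorted leq [tuple `|back_i l q.+1|%N | q < k.-1].
Proof.
apply/(sortedP 0%N) => q; rewrite size_tuple => qk.
rewrite -(tnth_nth 0%N _ (Ordinal qk)) -(tnth_nth 0%N _ (Ordinal (ltnW qk))).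
rewrite !tnth_mktuple /=.
have := @back_i_ge0 l q.+1; have := @back_i_step l q.+1; lia.
Qed.

Definition back (l : ksubset k) : idx k :=
  Idx (back_sorted l) (k%:Z - 1 - entry (val l) k).

End EllAndBack.

Section Plucker.
Variables (C : fieldType) (k : nat).

Local Notation pluPoly := {malg C[{cmonom (ksubset k)}]}.

Definition pluX (l : ksubset k) : pluPoly := << ucm l >>.

Definition inversions (s : seq int) : nat :=
  (\sum_(i < size s) \sum_(j < size s | (i < j)%N) (s`_j < s`_i)%R)%N.

(* The variable attached to an ordered list of k integers: antisymmetric in the
   list, equal to p_l on the increasing enumeration of l. *)
Definition pluL (s : seq int) : pluPoly :=
  if uniq s then
    if insub [fset z in s]%fset is Some l then (-1) ^+ inversions s * pluX l
    else 0
  else 0.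

Definition plu_rel (J' J : {fset int}) : pluPoly :=
  \sum_(l < k.+1) (-1) ^+ l * pluL (rcons (fsort J') (fsort J)`_l)
                           * pluL (fsort (J `\ (fsort J)`_l)%fset).

Definition is_plu_rel (u : pluPoly) : Prop :=
  exists J' J : {fset int},
    [/\ #|` J'| = k.-1, #|` J| = k.+1 & u = plu_rel J' J].

Definition plu_ideal : pred pluPoly := gen_ideal is_plu_rel.

Lemma pluL_coef1 s : mcoeff (@mone _) (pluL s) = 0.
Proof.
rewrite /pluL; case: ifP => _; last exact: mcoeff0.
case: insubP => [l _ _|_]; last exact: mcoeff0.
rewrite rmorphM /= /pluX mcoeffU1.
case: eqP => [/(congr1 (fun m : {cmonom _} => m l))|_]; last by rewrite mulr0.
by rewrite cmUU cm1.
Qed.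

Lemma plu_ideal_idealr : idealr_closed plu_ideal.
Proof.
split=> [||a u v Hu Hv].
- exact: gen_ideal0.
- apply/negP => /(@gen_ideal_ind _ _ (fun u => mcoeff (@mone _) u = 0)).
  move=> /(_ (mcoeff0 _)) H.
  have: (mcoeff (@mone _) (1 : pluPoly) : C) = 0.
    apply: H => c g u [J' [J [_ _ ->]]] u0.
    rewrite rmorphD rmorphM /= u0 addr0 rmorph_sum big1 ?mulr0 // => l _ /=.
    by rewrite rmorphM /= pluL_coef1 mulr0.
  by rewrite rmorph1 => /eqP; rewrite oner_eq0.
- by apply: gen_idealD => //; apply: gen_idealM.
Qed.

HB.instance Definition _ := isIdealr.Build pluPoly plu_ideal plu_ideal_idealr.

Definition pluA : Type := {ideal_quot (Idealr.clone _ plu_ideal _)}.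
HB.instance Definition _ := GRing.ComNzRing.on pluA.

Definition plu_coord (l : ksubset k) : pluA := (\pi_pluA (pluX l))%qT.

Definition plu_coords : Type := {a : pluA | exists l, a = plu_coord l}.

Definition to_plu_coords (l : ksubset k) : plu_coords :=
  exist _ (plu_coord l) (ex_intro _ l erefl).

End Plucker.

(* Main.v *)
(** A module [M] as in the statement is recovered from an embedding into [R].
    [Ext^1(M,R) = 0] makes every [R]-linear map [M -> R/(y^n)] lift to [R].
    The ring [R/(y^n)] is Frobenius, so a [C]-linear form on [M/y^n M] induces
    such a map; as the degrees of [M] are bounded above, no nonzero homogeneous
    [m] lies in every [y^n M], and hence some linear [M -> R] does not kill [m].
    Therefore [M -> M (x) F = F] is injective, and clearing denominators embeds
    [M] in [R] as a homogeneous ideal [J], up to a shift.  A homogeneous element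
    of [R] is its lowest monomial times a unit of the form [c + xy w], so [J] is
    spanned over [C[y]] by monomials [x^a y^b] with [b >= beta a], for a
    nonincreasing [beta]: this is some [I].

    Conversely the cokernel of [x - N], where [N] is the nilpotent matrix of
    multiplication by [x] on the [C[y]]-basis of generators of [I], is [I]; with
    [sum_a x^(k-1-a) N^a] it forms a matrix factorization of [x^k], whose
    2-periodic resolution stays exact after dualizing.  The entries of
    [l(I)] are determined by the nilpotency orders of [xy] on the graded pieces
    of [I], and distinct Plücker coordinates stay distinct because the Plücker
    relations have no linear term. *)

From HB Require Import structures.
Require Import Defs.
From mathcomp Require Import all_boot all_order all_algebra.
From mathcomp Require Import finmap.
From mathcomp Require Import boolp classical_sets reals complex.
From mathcomp.multinomials Require Import monalg.
From mathcomp Require Import zify.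

Set Implicit Arguments.
Unset Strict Implicit.
Unset Printing Implicit Defensive.

Import Order.TTheory GRing.Theory Num.Theory.
Local Open Scope ring_scope.

(** * The rings R and F *)

Section TruncatedPolynomials.
Variables (B : comNzRingType) (k : nat).
Hypothesis k_gt0 : (0 < k)%N.
Local Notation Q := {poly %/ ('X^k : {poly B})}.
Local Notation X := (in_qpoly ('X^k : {poly B}) 'X).
Local Notation cst := (qpolyC ('X^k : {poly B})).

Implicit Types r s : Q.

Lemma coef_in_qpoly (p : {poly B}) a :
  (in_qpoly 'X^k p : {poly B})`_a = if (a < k)%N then p`_a else 0.
Proof.
by rewrite /= mk_monic_Xn -Pdiv.RingMonic.take_poly_rmodp coef_take_poly prednK.
Qed.

Lemma qpolyXn_eqP r s :
  (forall a, (a < k)%N -> (r : {poly B})`_a = (s : {poly B})`_a) -> r = s.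
Proof.
move=> rs; apply: val_inj; apply/polyP => a /=; have [/rs //|ka] := ltnP a k.
by rewrite !nth_default // (leq_trans (size_npoly _)) // mk_monic_Xn size_polyXn /= prednK.
Qed.

Lemma coef_qpoly_ge r a : (k <= a)%N -> (r : {poly B})`_a = 0.
Proof.
move=> ka; rewrite nth_default // (leq_trans (size_npoly _)) //.
by rewrite mk_monic_Xn size_polyXn /= prednK.
Qed.

Lemma coef_qpolyM r s a : (a < k)%N ->
  (r * s : Q)`_a = ((r : {poly B}) * (s : {poly B}))`_a.
Proof. by move=> ak; rewrite coef_in_qpoly ak. Qed.

Lemma coef_qpolyCM c r a : (cst c * r : Q)`_a = c * (r : {poly B})`_a.
Proof.
have [ak|ka] := ltnP a k; first by rewrite coef_qpolyM //= coefCM.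
by rewrite !coef_qpoly_ge ?mulr0.
Qed.

Lemma coef_qpolyXM n r a :
  (X ^+ n * r : Q)`_a = if (n <= a < k)%N then (r : {poly B})`_(a - n) else 0.
Proof.
have -> : X ^+ n * r = in_qpoly 'X^k ('X^n * (r : {poly B})).
  rewrite in_qpolyM rmorphXn /=; congr (_ * _); apply: qpolyXn_eqP => b bk.
  by rewrite coef_in_qpoly bk.
by rewrite coef_in_qpoly coefXnM; case: (ltnP a k); case: (ltnP a n); rewrite ?andbT ?andbF.
Qed.

Lemma qpolyX_nilp : X ^+ k = 0.
Proof.
rewrite -[LHS]mulr1; apply: qpolyXn_eqP => a ak.
by rewrite coef_qpolyXM coef0 leqNgt ak.
Qed.

Lemma qpoly_sumE r : r = \sum_(a < k) cst (r : {poly B})`_a * X ^+ a.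
Proof.
apply: qpolyXn_eqP => a ak; rewrite raddf_sum coef_sum (bigD1 (Ordinal ak)) //=.
rewrite -[X ^+ a]mulr1 coef_qpolyCM coef_qpolyXM leqnn ak subnn coef1 mulr1.
rewrite big1 ?addr0 // => i; rewrite -val_eqE /= => ia.
rewrite -[X ^+ i]mulr1 coef_qpolyCM coef_qpolyXM ak andbT coef1.
case: leqP => [ia'|_]; last by rewrite mulr0.
by rewrite subn_eq0 leqNgt ltn_neqAle ia' ia mulr0.
Qed.

End TruncatedPolynomials.

Section RingR.
Variables (C : fieldType) (k : nat).
Hypothesis k_gt0 : (0 < k)%N.
Local Notation R := (ringR C k).
Local Notation x := (xR C k).
Local Notation y := (yR C k).
Local Notation cst := (qpolyC ('X^k : {poly {poly C}}) : {poly C} -> R).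
Implicit Types r s : R.

Lemma yR_E : y = cst 'X.
Proof.
apply: qpolyXn_eqP => // a ak.
by rewrite coef_in_qpoly // ak.
Qed.

Lemma yRX n : y ^+ n = cst 'X^n.
Proof. by rewrite yR_E rmorphXn. Qed.

Lemma coef_yXM n r a : (y ^+ n * r : R)`_a = 'X^n * (r : {poly {poly C}})`_a.
Proof. by rewrite yRX coef_qpolyCM. Qed.

Lemma coef_xXM n r a :
  (x ^+ n * r : R)`_a = if (n <= a < k)%N then (r : {poly {poly C}})`_(a - n) else 0.
Proof. exact: coef_qpolyXM. Qed.

(** [R] is free over the domain C[y]. *)
Lemma yRX_reg n r : y ^+ n * r = 0 -> r = 0.
Proof.
move=> yr0; apply: qpolyXn_eqP => // a ak.
have /eqP := congr1 (fun u : R => (u : {poly {poly C}})`_a) yr0.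
by rewrite coef_yXM coef0 mulf_eq0 expf_eq0 polyX_eq0 andbF orFb => /eqP.
Qed.

Lemma yRX_inj n : injective (fun r : R => y ^+ n * r).
Proof.
by move=> r s /eqP; rewrite -subr_eq0 -mulrBr => /eqP/yRX_reg/eqP; rewrite subr_eq0 => /eqP.
Qed.

Lemma coef_mon a b i j : (a < k)%N ->
  (x ^+ a * y ^+ b : R)`_i`_j = ((i == a) && (j == b))%:R.
Proof.
move=> ak; rewrite coef_xXM yRX /= coefC subn_eq0.
have [->|ia] := eqVneq i a; first by rewrite leqnn ak /= coefXn.
case: ifP => [/andP[ai _]|_]; last by rewrite coef0.
by rewrite leqNgt ltn_neqAle eq_sym ia ai coef0.
Qed.

Lemma mon_neq0 a b : (a < k)%N -> x ^+ a * y ^+ b != 0 :> R.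
Proof.
move=> ak; apply/eqP => /(congr1 (fun u : R => (u : {poly {poly C}})`_a`_b)).
by rewrite coef_mon // !eqxx !coef0 => /eqP; rewrite oner_eq0.
Qed.

Lemma partR_mon a b : partR (a%:Z - b%:Z) (x ^+ a * y ^+ b : R).
Proof.
apply: partRM; first by rewrite -[a%:Z]natz; exact: (partRX (@partR_x C k)).
by rewrite -[b%:Z]natz -mulNrn; exact: (partRX (@partR_y C k)).
Qed.

Lemma partR_yX d n r : partR d (y ^+ n * r) -> partR (d + n%:Z) r.
Proof.
move=> H a b nz; have := H a (b + n)%N.
rewrite coef_yXM mulrC coefMXn ltnNge leq_addl addnK => /(_ nz) <-.
by rewrite PoszD opprD addrA subrK.
Qed.

Lemma partRN d r : partR d r -> partR d (- r).
Proof. by move=> H a b; rewrite /= !coefN oppr_eq0; exact: H. Qed.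

(** Only x has positive degree, and x^k = 0. This is the source of the upper bound on degrees in
    finitely generated modules. *)
Lemma partR_lt d r : partR d r -> r != 0 -> d < k%:Z.
Proof.
move=> H; apply: contra_neqT; rewrite -leNgt => kd; apply: qpolyXn_eqP => // a ak.
apply/polyP => b; rewrite !coef0; apply/eqP; apply: contraT => /H; lia.
Qed.

End RingR.

(** * The localization map from R to F *)

Section LaurentLocalization.
Variables (C : fieldType) (k : nat).
Hypothesis k_gt0 : (0 < k)%N.
Local Notation R := (ringR C k).
Local Notation F := (ringF C k).
Local Notation x := (xR C k).
Local Notation y := (yR C k).
Local Notation lp := (@laurent_of_poly C).
Implicit Types (r s : R) (f g : F).

Lemma laurent_of_poly_zmod : zmod_morphism lp.
Proof. by move=> p q; apply: val_inj; rewrite /= tofracB. Qed.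

Lemma laurent_of_poly_monoid : monoid_morphism lp.
Proof. by split=> [|p q]; apply: val_inj; rewrite /= ?tofrac1 ?tofracM. Qed.

HB.instance Definition _ :=
  GRing.isZmodMorphism.Build {poly C} (laurent C) lp laurent_of_poly_zmod.
HB.instance Definition _ :=
  GRing.isMonoidMorphism.Build {poly C} (laurent C) lp laurent_of_poly_monoid.

Lemma laurent_of_poly_inj : injective lp.
Proof. by move=> p q /(congr1 val) /= /eqP; rewrite tofrac_eq => /eqP. Qed.

Lemma coef_loc r a : (loc r : {poly laurent C})`_a = lp (r : {poly {poly C}})`_a.
Proof.
rewrite /loc coef_in_qpoly // coef_map; case: ltnP => // ka.
by rewrite coef_qpoly_ge // raddf0.
Qed.

Lemma locD r s : loc (r + s) = loc r + loc s.
Proof.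
by apply: (qpolyXn_eqP k_gt0) => a _; rewrite coefD !coef_loc /= coefD raddfD.
Qed.

Lemma locM r s : loc (r * s) = loc r * loc s.
Proof.
apply: (qpolyXn_eqP k_gt0) => a ak; rewrite coef_loc !coef_qpolyM // !coefM raddf_sum.
by apply: eq_bigr => i _; rewrite !coef_loc; exact: rmorphM.
Qed.

Lemma loc1 : loc (1 : R) = 1.
Proof.
apply: (qpolyXn_eqP k_gt0) => a ak; rewrite coef_loc /= !coef1.
by case: eqP => _; rewrite ?rmorph1 ?rmorph0.
Qed.

Lemma loc0 : loc (0 : R) = 0.
Proof. by apply: (addrI (loc (0 : R))); rewrite -locD !addr0. Qed.

Lemma loc_inj : injective (@loc C k).
Proof.
move=> r s E; apply: (qpolyXn_eqP k_gt0) => a _; apply: laurent_of_poly_inj.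
by rewrite -!coef_loc E.
Qed.

Lemma laurent_Xinv_subproof : (tofrac 'X : {fraction {poly C}})^-1 \in @laurent_pred C.
Proof. by apply/asboolP; exists 1, 1%N; rewrite tofrac1 expr1 mul1r. Qed.

Definition laurent_Xinv : laurent C := Laurent laurent_Xinv_subproof.

Lemma laurent_XV : lp 'X * laurent_Xinv = 1.
Proof. by apply: val_inj; rewrite /= divff // tofrac_eq0 polyX_eq0. Qed.

Lemma loc_yX n : loc (y ^+ n) = qpolyC 'X^k (lp 'X ^+ n).
Proof.
apply: (qpolyXn_eqP k_gt0) => b _.
rewrite coef_loc yRX //= !coefC; case: eqP => _; first exact: rmorphXn.
by rewrite raddf0.
Qed.

Lemma coef_loc_yXM n f a :
  (loc (y ^+ n) * f : F)`_a = lp 'X ^+ n * (f : {poly laurent C})`_a.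
Proof. by rewrite loc_yX coef_qpolyCM. Qed.

Lemma loc_yX_unit n : exists f, loc (y ^+ n) * f = 1.
Proof.
exists (qpolyC 'X^k (laurent_Xinv ^+ n)).
by rewrite loc_yX -qpolyCM -exprMn laurent_XV expr1n.
Qed.

Lemma laurent_valX (u : laurent C) n : laurent_val (u ^+ n) = laurent_val u ^+ n.
Proof. by elim: n => [|n IHn] //; rewrite !exprS -IHn. Qed.

Lemma loc_surj f : exists n r, loc (y ^+ n) * f = loc r.
Proof.
have coefP (a : 'I_k) : {pn : {poly C} * nat |
    (f : {poly laurent C})`_a * lp 'X ^+ pn.2 = lp pn.1}.
  apply: cid; case: ((f : {poly laurent C})`_a) => u uP; case/asboolP: (uP) => p [n uE].
  exists (p, n); apply: val_inj; rewrite /= laurent_valX /= uE.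
  by rewrite divfK // fracX_neq0.
(* [N] is a common exponent for the denominators of all coefficients, and [P a] is the numerator of
   the coefficient of x^a over y^N. *)
pose N := \max_(a < k) (sval (coefP a)).2.
pose P (a : 'I_k) := (sval (coefP a)).1 * 'X^(N - (sval (coefP a)).2).
pose r : R := \sum_(a < k) qpolyC 'X^k (P a) * x ^+ a.
have rE a (ak : (a < k)%N) : (r : {poly {poly C}})`_a = P (Ordinal ak).
  rewrite /r raddf_sum coef_sum (bigD1 (Ordinal ak)) //= big1 => [|i].
    rewrite addr0 coef_qpolyCM // -[x ^+ a]mulr1 coef_xXM // leqnn ak subnn.
    by rewrite coef1 mulr1.
  rewrite -val_eqE /= => ia; rewrite coef_qpolyCM // -[x ^+ i]mulr1 coef_xXM //.
  case: ifP => [/andP[ia' _]|_]; last by rewrite mulr0.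
  by rewrite coef1 subn_eq0 leqNgt ltn_neqAle ia ia' mulr0.
exists N, r; apply: (qpolyXn_eqP k_gt0) => a ak; rewrite coef_loc_yXM coef_loc rE.
rewrite /P; case: (coefP _) (@leq_bigmax _ (fun a => (sval (coefP a)).2) (Ordinal ak)).
move=> [p n] /= fE nN; rewrite rmorphM rmorphXn /= -fE -mulrA -exprD mulrC.
by rewrite subnKC.
Qed.

Lemma partF_M d e f g : partF d f -> partF e g -> partF (d + e) (f * g).
Proof.
move=> Hf Hg a; have [ka|ak] := leqP k a.
  by exists 0; rewrite coef_qpoly_ge // tofrac0 mul0r.
have [cf cfE] := choice Hf; have [cg cgE] := choice Hg.
exists (\sum_(i < a.+1) cf i * cg (a - i)%N).
rewrite coef_qpolyM // coefM (big_morph (@laurent_val C) (fun _ _ => erefl) erefl).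
rewrite !rmorph_sum /= mulr_suml.
apply: eq_bigr => i _; rewrite /= cfE cgE polyCM tofracM mulrACA; congr (_ * _).
rewrite -expfzDr ?tofrac_eq0 ?polyX_eq0 //; congr (_ ^ _).
by have := ltn_ord i; lia.
Qed.

Lemma partF_loc d r : partF d (loc r) <-> partR d r.
Proof.
have toN a : 0 <= a%:Z - d -> exists n : nat, a%:Z - d = n%:Z.
  by exists `|(a%:Z - d)|%N; lia.
split=> H a; last first.
  case: (leP 0 (a%:Z - d)) => [/toN[n en]|e0].
    exists (r : {poly {poly C}})`_a`_n; rewrite coef_loc /= en -exprnP -tofracXn -tofracM.
    congr tofrac; apply/polyP => b; rewrite coefCM coefXn.
    have [->|/eqP bn] := eqVneq b n; first by rewrite mulr1.
    by rewrite mulr0; apply/eqP; apply: contraT => /H; lia.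
  exists 0; suff /= pa0 : (r : {poly {poly C}})`_a = 0.
    by rewrite coef_loc pa0 /= !tofrac0 mul0r.
  by apply/polyP => b; rewrite coef0; apply/eqP; apply: contraT => /H; lia.
move=> b; have [c] := H a; rewrite coef_loc /=.
set p := _`_a; have X0 : tofrac 'X != 0 :> {fraction {poly C}}.
  by rewrite tofrac_eq0 polyX_eq0.
case: (leP 0 (a%:Z - d)) => [/toN[n en]|e0] pE.
  move: pE; rewrite en -exprnP -tofracXn -tofracM => /eqP.
  rewrite tofrac_eq => /eqP ->; rewrite coefCM coefXn.
  by case: (b =P n) => [->|_]; rewrite ?mulr0 ?eqxx // mulr1; lia.
(* Here the power of y is negative: multiplying by y^n with n > 0 turns the polynomial [p] into a
   constant, so [p] is 0. *)
have [n en] : exists n : nat, d - a%:Z = n%:Z by exists `|(d - a%:Z)|%N; lia.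
have : tofrac (p * 'X^n) = tofrac c%:P :> {fraction {poly C}}.
  rewrite tofracM pE tofracXn -mulrA exprnP -expfzDr //.
  by rewrite (_ : _ + _ = 0) ?expr0z ?mulr1 //; lia.
move=> /eqP; rewrite tofrac_eq => /eqP /(congr1 (fun q : {poly C} => q`_(b + n))).
rewrite coefMXn ltnNge leq_addl addnK /= coefC addn_eq0.
by case: (n =P 0%N) => [n0|_ ->]; rewrite ?andbF ?eqxx //; lia.
Qed.

End LaurentLocalization.

(** * Plücker coordinates and k-subsets *)

Section PluckerCoordinates.
Variables (C : fieldType) (k : nat).
Local Notation pluPoly := {malg C[{cmonom (ksubset k)}]}.

Lemma mcoeffM_eq0 (u v : pluPoly) (m : {cmonom (ksubset k)}) :
  (forall m1 m2 : {cmonom (ksubset k)}, m = mmul m1 m2 -> mcoeff m1 u * mcoeff m2 v = 0) ->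
  mcoeff m (u * v) = 0.
Proof.
move=> uv0; rewrite mcoeffMl big1 // => m1 _; rewrite big1 // => m2 _.
by case: eqP => [E|_]; rewrite ?mulr0n // uv0 ?mul0rn.
Qed.

(** A monomial of degree 1 factors only as itself times 1, so its coefficient in a product involves
    only constant and linear coefficients of the factors. *)
Lemma mcoeff_ucmM (l : ksubset k) (u v : pluPoly) :
  mcoeff (@mone _) v = 0 ->
  mcoeff (@mone _) u = 0 \/ mcoeff (ucm l) v = 0 -> mcoeff (ucm l) (u * v) = 0.
Proof.
move=> v1 uv; apply: mcoeffM_eq0 => m1 m2 lE.
have := congr1 (@mdeg _) lE; rewrite mdegU mdegM => dE.
have [m20|m20] := eqVneq (mdeg m2) 0%N.
  by rewrite (mdeg_eq0I m20) v1 mulr0.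
have m10 : mdeg m1 = 0%N by lia.
move: lE; rewrite (mdeg_eq0I m10) mul1m => <-.
by case: uv => ->; rewrite ?mul0r ?mulr0.
Qed.

(* The Plücker relations are quadratic, so no element of the ideal they
   generate has a linear term. *)
Lemma plu_ideal_ucm (l : ksubset k) (u : pluPoly) :
  u \in @plu_ideal C k -> mcoeff (ucm l) u = 0.
Proof.
move: u; apply: gen_ideal_ind => [|c g u]; first exact: mcoeff0.
move=> [J' [J [_ _ ->]]] u0; rewrite mcoeffD u0 addr0.
have rel1 : mcoeff (@mone _) (plu_rel C k J' J) = 0.
  by rewrite rmorph_sum big1 // => i _ /=; rewrite rmorphM /= pluL_coef1 mulr0.
apply: mcoeff_ucmM => //; right; rewrite raddf_sum big1 // => i _ /=.
apply: mcoeff_ucmM; rewrite ?pluL_coef1 //; left.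
by rewrite rmorphM /= pluL_coef1 mulr0.
Qed.

Lemma mcoeff_pluX (l l' : ksubset k) : mcoeff (ucm l) (pluX C l') = (l' == l)%:R.
Proof.
have ucm_inj : ucm l' = ucm l -> l' = l.
  by move=> E; have := cmUU l; rewrite -{1}E cmU; case: (l' =P l).
rewrite /pluX mcoeffU1; have [->|ll'] := eqVneq l' l; first by rewrite eqxx.
by case: (ucm l' =P ucm l) => [/ucm_inj E|//]; rewrite E eqxx in ll'.
Qed.

Lemma plu_coord_inj : injective (@plu_coord C k).
Proof.
move=> l l' ll'.
have : pluX C l - pluX C l' \in @plu_ideal C k.
  by rewrite Quotient.idealrBE; apply/eqP.
move=> /(plu_ideal_ucm l) ll'0.
have : (l == l)%:R - (l' == l)%:R = 0 :> C.
  by rewrite -(mcoeff_pluX l l) -(mcoeff_pluX l l') -mcoeffB.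
rewrite eqxx; case: (l' =P l) => [//|_].
by move=> /eqP; rewrite subr0 oner_eq0.
Qed.

End PluckerCoordinates.

Section KSubsets.
Variable k : nat.
Hypothesis k_gt0 : (0 < k)%N.

Lemma idx_eqP (I J : idx k) :
  idx_tw I = idx_tw J -> (forall q, (q < k)%N -> idx_i I q = idx_i J q) -> I = J.
Proof.
case: I J => [t s w] [t' s' w'] /= -> H.
have E : t = t'.
  apply: eq_from_tnth => i; rewrite !(tnth_nth 0%N).
  by have := H i.+1; rewrite /idx_i /=; apply; rewrite -ltn_predRL ltn_ord.
by case: t' / E s' {H} => s'; rewrite (bool_irrelevance s s').
Qed.

(** As i_0 = 0, the entry l_k gives the twist; then l_(k-q) gives i_q. *)
Lemma ell_entry_inj (I J : idx k) :
  (forall p, (0 < p <= k)%N -> ell_entry I p = ell_entry J p) -> I = J.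
Proof.
move=> E; have twE : idx_tw I = idx_tw J.
  by have := E k; rewrite k_gt0 leqnn /ell_entry subnn /idx_i /= => /(_ isT); lia.
apply: idx_eqP => // q qk; have := E (k - q)%N; rewrite /ell_entry twE.
by rewrite subn_gt0 qk leq_subr subKn ?(ltnW qk) // => /(_ isT); lia.
Qed.

Lemma fsort_ell (I : idx k) :
  fsort (val (ell I)) = [seq ell_entry I p | p <- iota 1 k].
Proof.
apply: (@irr_sorted_eq _ <%R); first exact: lt_trans.
- exact: ltxx.
- by rewrite lt_sorted_uniq_le sort_uniq fset_uniq sort_le_sorted.
- rewrite sorted_map; apply: (@sub_in_sorted _ (mem (iota 1 k)) ltn); last first.
  + exact: iota_ltn_sorted.
  + by apply/allP.
  move=> p p'; rewrite !mem_iota => /andP[p0 _] /andP[_ pk] pp'.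
  by apply: ell_entry_lt => //; apply/andP; split; [exact: pp' | rewrite -ltnS -add1n].
move=> z; rewrite mem_sort -[LHS]/(z \in ell_fset I).
by apply/imfsetP/mapP => [[p /= pk ->]|[p pk ->]]; exists p.
Qed.

Lemma entry_ell (I : idx k) p : (0 < p <= k)%N -> entry (val (ell I)) p = ell_entry I p.
Proof.
case: p => // p /= pk.
by rewrite /entry fsort_ell (nth_map 0%N) ?size_iota // nth_iota // add1n.
Qed.

Lemma size_fsort (l : ksubset k) : size (fsort (val l)) = k.
Proof. by rewrite size_sort; apply/eqP; apply: (valP l). Qed.

Lemma idx_i_back (l : ksubset k) q : (q < k)%N ->
  (idx_i (back l) q)%:Z = back_i l q.
Proof.
case: q => [|q] qk; first by rewrite back_i0.
have qk' : (q < k.-1)%N by rewrite ltn_predRL.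
rewrite /idx_i -[nth _ _ _]/(nth 0%N (idx_t (back l)) (Ordinal qk')) -tnth_nth.
rewrite tnth_mktuple /=.
by rewrite gez0_abs // back_i_ge0.
Qed.

Lemma ell_entry_back (l : ksubset k) p : (0 < p <= k)%N ->
  ell_entry (back l) p = entry (val l) p.
Proof.
move=> /andP[p0 pk]; rewrite /ell_entry idx_i_back ?ltn_subrL ?p0 //.
by rewrite /back_i /= subKn //; lia.
Qed.

Lemma ellK : cancel (@ell k) (@back k).
Proof.
by move=> I; apply: ell_entry_inj => p pk; rewrite ell_entry_back // entry_ell.
Qed.

Lemma backK : cancel (@back k) (@ell k).
Proof.
move=> l; apply: val_inj; apply/fsetP => z.
rewrite -[LHS](mem_sort <=%R) -[RHS](mem_sort <=%R) -!/(fsort _).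
congr (z \in _); apply: (@eq_from_nth _ 0); rewrite ?size_fsort // => p pk.
have := ell_entry_back l (p := p.+1); rewrite -entry_ell /entry //=; exact.
Qed.

End KSubsets.

(** * The modules I have rank one and are pairwise non-isomorphic *)

(** Bundles, inside a proof, a function given by a formula or obtained by choice. *)
Lemma linear_pack (A : nzRingType) (U V : lmodType A) (f : U -> V) :
  (forall a u v, f (a *: u + v) = a *: f u + f v) ->
  exists g : {linear U -> V}, g =1 f.
Proof.
move=> fL; pose m := GRing.isLinear.Build A U V _ f fL.
by exists (HB.pack_for {linear U -> V} f m).
Qed.

(** * Matrix factorizations of x^k *)

Section MatrixFactorization.
Variables (B : idomainType) (k : nat).
Hypothesis k_gt0 : (0 < k)%N.
Local Notation S := {poly B}.
Local Notation Q := {poly %/ ('X^k : {poly B})}.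
Local Notation pr := (in_qpoly ('X^k : {poly B})).

Lemma in_qpoly_eq0 (p : S) : pr p = 0 -> p = 'X^k * drop_poly k p.
Proof.
move=> p0; apply/polyP => a; rewrite coefXnM coef_drop_poly; case: ltnP => ak.
  by have := coef_in_qpoly k_gt0 p a; rewrite ak p0 coef0.
by rewrite subnK.
Qed.

Lemma map_in_qpoly_lift m n (v : 'M[Q]_(m, n)) :
  map_mx pr (map_mx (fun q : Q => q : {poly B}) v) = v.
Proof.
apply/matrixP => i j; rewrite !mxE; apply: (qpolyXn_eqP k_gt0) => a ak.
by rewrite coef_in_qpoly // ak.
Qed.

(** Since det A divides a power of x, it is nonzero, and the adjugate allows A to be cancelled from
    A (D A - x^k) = 0 over the domain B[x]. *)
Lemma mf_mulC n (A D : 'M[S]_n) :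
  A *m D = ('X^k)%:M -> D *m A = ('X^k)%:M.
Proof.
move=> AD; have detA : \det A != 0.
  apply/eqP => dA0; have := congr1 determinant AD.
  by rewrite det_mulmx dA0 mul0r det_scalar => /esym/eqP; rewrite !expf_eq0 polyX_eq0 !andbF.
apply/eqP; rewrite -subr_eq0; apply/eqP.
have : A *m (D *m A - ('X^k)%:M) = 0.
  by rewrite mulmxBr mulmxA AD scalar_mxC subrr.
move=> /(congr1 (mulmx (\adj A))); rewrite mulmxA mul_adj_mx mulmx0 mul_scalar_mx.
by move=> /eqP; rewrite scalemx_eq0 (negbTE detA) => /eqP.
Qed.

(** Lift v to v' over B[x]. Then v' A = x^k W = W D A for some W, and A cancels, because multiplying
    by D turns it into the nonzerodivisor x^k. *)
Lemma mf_exact_l m n (A D : 'M[S]_n) (v : 'M[Q]_(m, n)) :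
    A *m D = ('X^k)%:M -> v *m map_mx pr A = 0 ->
  exists w : 'M[Q]_(m, n), v = w *m map_mx pr D.
Proof.
move=> AD vA; have DA := mf_mulC AD; pose v' := map_mx (fun q : Q => q : {poly B}) v.
pose W := map_mx (drop_poly k) (v' *m A).
have v'A : v' *m A = 'X^k *: W.
  apply/matrixP => i j; rewrite [RHS]mxE [in RHS]mxE; apply: in_qpoly_eq0.
  have := congr1 (fun M : 'M[Q]_(m, n) => M i j) vA.
  by rewrite -{1}(map_in_qpoly_lift v) -map_mxM !mxE.
have : (v' - W *m D) *m A = 0.
  by rewrite mulmxBl v'A -mulmxA DA scalar_mxC mul_scalar_mx subrr.
move=> /(congr1 (mulmx^~ D)) /=; rewrite -mulmxA AD mul0mx scalar_mxC mul_scalar_mx.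
move=> /eqP; rewrite scalemx_eq0 expf_eq0 polyX_eq0 andbF subr_eq0 => /eqP v'E.
by exists (map_mx pr W); rewrite -map_mxM -v'E map_in_qpoly_lift.
Qed.

(** The transpose of [mf_exact_l]; it gives exactness of the dualized resolution. *)
Lemma mf_exact_r m n (A D : 'M[S]_n) (c : 'M[Q]_(n, m)) :
    A *m D = ('X^k)%:M -> map_mx pr A *m c = 0 ->
  exists w : 'M[Q]_(n, m), c = map_mx pr D *m w.
Proof.
move=> AD Ac; have [||w cE] := @mf_exact_l m n A^T D^T c^T.
- by rewrite -trmx_mul (mf_mulC AD) tr_scalar_mx.
- by rewrite -map_trmx -trmx_mul Ac trmx0.
by exists w^T; rewrite -[LHS]trmxK cE trmx_mul map_trmx trmxK.
Qed.

End MatrixFactorization.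

Lemma projective_rV (A : comNzRingType) n : projective 'rV[A]_n.
Proof.
move=> U V f g f_surj.
have [u uE] := choice (fun i : 'I_n => f_surj (g (delta_mx 0 i))).
have [|h hE] := @linear_pack A 'rV[A]_n U (fun v => \sum_i v 0 i *: u i).
  move=> a v w; rewrite scaler_sumr -big_split; apply: eq_bigr => i _ /=.
  by rewrite !mxE scalerDl scalerA.
exists h => v; rewrite hE linear_sum [in RHS](row_sum_delta v) linear_sum.
by apply: eq_bigr => i _; rewrite !linearZ /= uE.
Qed.

Lemma idx_i0 k (I : idx k) : idx_i I 0 = 0%N.
Proof. by []. Qed.

(** * The 2-periodic free resolution of I *)

Section PeriodicResolution.
Variables (C : fieldType) (k : nat) (I : idx k).
Hypothesis k_gt0 : (0 < k)%N.
Local Notation R := (ringR C k).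
Local Notation S := {poly {poly C}}.
Local Notation x := (xR C k).
Local Notation y := (yR C k).
Local Notation i_ := (idx_i I).
Local Notation pr := (in_qpoly ('X^k : S)).
Local Notation M := (ideal_mod (@idx_gens C k I)).

(* The rows of [mfA] are the syzygies y^(i_q - i_(q-1)) g_(q-1) = x g_q of the
   generators g_q = x^(k-1-q) y^(i_q), which form the column 0 of [mfB]. *)
Definition mfA : 'M[S]_k := \matrix_(q, p)
  (if q == p then 'X else if q == p.+1 :> nat then - ('X^(i_ q - i_ p))%:P else 0).
Definition mfB : 'M[S]_k := \matrix_(q, p)
  (if (p <= q)%N then 'X^(k.-1 - q + p) * ('X^(i_ q - i_ p))%:P else 0).

(** [mfA] is x - N with N strictly lower triangular, and the entries of N^a telescope to y^(i_q -
    i_(q-a)), so [mfB] is the sum of the x^(k-1-a) N^a. The product is x^k - N^k, and N^k = 0. *)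
Lemma mfAB : mfA *m mfB = ('X^k)%:M.
Proof.
apply/matrixP => q p; rewrite !mxE (bigD1 q) //= !mxE eqxx.
have qk := ltn_ord q.
have [q0|q_gt0] := posnP q.
  rewrite big1 => [|r rq]; last first.
    rewrite !mxE eq_sym (negbTE rq) ifF ?mul0r //.
    by rewrite q0.
  rewrite addr0 -val_eqE /= q0 leqn0 eq_sym; case: eqP => [->|_]; last by rewrite mulr0.
  by rewrite subnn mulr1 subnK ?(leq_trans (ltn_ord _)) -?exprS ?prednK //; have := ltn_ord p; lia.
(* Row q > 0 of [mfA] meets only the rows q and q-1 of [mfB], whose contributions cancel off the
   diagonal. *)
have q1k : (q.-1 < k)%N by lia.
rewrite (bigD1 (Ordinal q1k)) /=; last by apply/eqP => /(congr1 val) /=; lia.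
rewrite big1 ?addr0 => [|r /andP[rq rq1]]; last first.
  rewrite !mxE eq_sym (negbTE rq) ifF ?mul0r //.
  by apply/negbTE; move: rq1; rewrite -!val_eqE /=; lia.
have q_pred : (q == q.-1 :> nat) = false by lia.
have q_succ : (q == q.-1.+1 :> nat) by lia.
rewrite !mxE -!val_eqE /= q_pred q_succ; have [<-|pq] := eqVneq (q : nat) p.
  rewrite leqnn subnn mulr1 subnK -?exprS ?prednK //; last by lia.
  by rewrite ifF ?mulr0 ?addr0 //; lia.
rewrite mulr0n; case: (leqP p q) => [pleq|qp]; last first.
  by rewrite ifF ?mulr0 ?addr0 //; lia.
have pq1 : (p <= q.-1)%N by lia.
rewrite pq1 mulNr; apply/eqP; rewrite subr_eq0 mulrA -exprS [eqbRHS]mulrCA -polyCM -exprD.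
have m1 := @idx_i_mono k I p q.-1; have m2 := @idx_i_mono k I q.-1 q.
by apply/eqP; congr ('X^_ * ('X^_)%:P); lia.
Qed.

Let Ah : 'M[R]_k := map_mx pr mfA.
Let Bh : 'M[R]_k := map_mx pr mfB.
Let j0 : 'I_k := Ordinal k_gt0.

Lemma mfB_E q p : Bh q p =
  if (p <= q)%N then x ^+ (k.-1 - q + p) * y ^+ (i_ q - i_ p) else 0.
Proof.
rewrite !mxE; case: ifP => _; last exact: raddf0.
by rewrite rmorphM rmorphXn polyC_exp rmorphXn.
Qed.

(** Up to the nonzerodivisor y^(i_p), column p of [mfB] is x^p times column 0; where the entry of
    column p is 0, the exponent of x on the right is at least k. Hence the augmentation, which reads
    column 0, has the same kernel as [Bh]. *)
Lemma mfB_col (v : 'rV[R]_k) (p : 'I_k) :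
  y ^+ i_ p * (v *m Bh) 0 p = x ^+ p * (v *m Bh) 0 j0.
Proof.
rewrite !mxE !mulr_sumr; apply: eq_bigr => q _; rewrite !mfB_E /=.
rewrite addn0 idx_i0 subn0 mulrCA [RHS]mulrCA; congr (_ * _).
have qk := ltn_ord q; case: leqP => pq; last first.
  rewrite mulr0 mulrA -exprD (_ : (p + _ = k + (p - q.+1))%N); last by lia.
  by rewrite exprD qpolyX_nilp // !mul0r.
rewrite mulrCA -exprD mulrA -exprD addnC; congr (_ * _ ^+ _).
by rewrite subnKC // idx_i_mono ?pq.
Qed.

Lemma idx_gens_aug (v : 'rV[R]_k) : (v *m Bh) 0 j0 \in gen_ideal (@idx_gens C k I).
Proof.
rewrite mxE; elim/big_ind: _ => [||q _]; first exact: gen_ideal0.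
  exact: gen_idealD.
apply: gen_ideal_mem; exists q; first exact: ltn_ord.
by rewrite mfB_E /= addn0 idx_i0 subn0.
Qed.

Lemma ker_aug (v : 'rV[R]_k) : (v *m Bh) 0 j0 = 0 -> v *m Bh = 0.
Proof.
move=> v0; apply/rowP => p; rewrite [RHS]mxE; apply: (@yRX_reg _ _ k_gt0 (i_ p)).
by rewrite mfB_col v0 mulr0.
Qed.

(** The differentials act on row vectors and alternate between [Ah] and [Bh]. Linear forms on R^k
    are columns, on which the same matrices act from the left, and [mf_exact_r] makes this dual
    complex exact in positive degrees. *)
Lemma gens_resolution : exists P : proj_resolution M,
  forall i (f : {linear P i.+1 -> R^o}), ext_cocycle f -> ext_coboundary f.
Proof.
pose D n := if odd n then Bh else Ah.
have DD n : D n.+1 *m D n = 0.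
  have E : (forall U : 'M[R]_k, U = 0 -> U = map_mx pr ('X^k)%:M).
    move=> _ ->; apply/esym; apply/matrixP => i j; rewrite !mxE.
    by rewrite rmorphMn rmorphXn /= qpolyX_nilp // mul0rn.
  apply: (etrans _ (esym (E 0 erefl))); rewrite /D /=; case: (odd n) => /=.
    by rewrite -map_mxM mfAB.
  by rewrite -map_mxM (mf_mulC mfAB).
have exL n (v : 'rV[R]_k) : v *m D n = 0 -> exists w, w *m D n.+1 = v.
  rewrite /D /=; case: (odd n) => /= v0.
    by have [w ->] := mf_exact_l k_gt0 (mf_mulC mfAB) v0; exists w.
  by have [w ->] := mf_exact_l k_gt0 mfAB v0; exists w.
have exR n (c : 'cV[R]_k) : D n.+1 *m c = 0 -> exists w, c = D n *m w.
  rewrite /D /=; case: (odd n) => /= v0.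
    by have [w ->] := mf_exact_r k_gt0 mfAB v0; exists w.
  by have [w ->] := mf_exact_r k_gt0 (mf_mulC mfAB) v0; exists w.
have [|aug augE] := @linear_pack R 'rV[R]_k M (fun v => IdealMod (idx_gens_aug v)).
  by move=> a u v; apply: val_inj; rewrite /= mulmxDl -scalemxAl !mxE.
have aug_surj m : exists v, aug v = m.
  case: m => m mG; suff [v vE] : exists v : 'rV[R]_k, (v *m Bh) 0 j0 = m.
    by exists v; rewrite augE; apply: val_inj.
  move: m mG; apply: gen_ideal_ind; first by exists 0; rewrite mul0mx mxE.
  move=> c _ _ [q qk ->] [v <-]; exists (c *: delta_mx 0 (Ordinal qk) + v).
  rewrite mulmxDl -scalemxAl -rowE [LHS]mxE [X in X + _]mxE [X in _ * X]mxE.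
  by rewrite mfB_E /= addn0 idx_i0 subn0.
pose P := @ProjResolution R M (fun _ => 'rV[R]_k : lmodType R)
  (fun n => mulmxr (D n) : {linear _ -> _}) aug (fun _ => @projective_rV R k) aug_surj.
(* By [ker_aug] the augmentation has the kernel of [D 1], which is the image of [D 2]; and [D 2] is
   [D 0] again. *)
have ex0 : forall p : 'rV[R]_k, aug p = 0 <-> exists q : 'rV[R]_k, q *m D 0%N = p.
  move=> v; rewrite augE; split=> [/(congr1 val) /= /ker_aug /(exL 1%N) [w <-]|[w <-]].
    by exists w.
  by apply: val_inj; rewrite /= -mulmxA [Ah *m _](DD 1%N) mulmx0 mxE.
have exS n : forall p : 'rV[R]_k, p *m D n = 0 <-> exists q : 'rV[R]_k, q *m D n.+1 = p.
  by move=> v; split=> [/exL//|[w <-]]; rewrite -mulmxA DD mulmx0.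
exists (P ex0 exS) => i f fc; pose c : 'cV[R]_k := \col_q (f (delta_mx 0 q) : R).
have fE (v : 'rV[R]_k) : (f v : R) = (v *m c) 0 0.
  rewrite [in LHS](row_sum_delta v) linear_sum mxE; apply: eq_bigr => q _.
  by rewrite linearZ mxE.
have [w cE] : exists w, c = D i *m w.
  apply: exR; apply/matrixP => q z; rewrite ord1.
  have := fc (delta_mx 0 q); rewrite fE /= -mulmxA => E.
  by rewrite [RHS]mxE -[RHS]E -rowE [in RHS]mxE.
have [|g gE] := @linear_pack R 'rV[R]_k R^o (fun v => (v *m w) 0 0).
  by move=> a u v; rewrite mulmxDl -scalemxAl !mxE.
by exists g => v; rewrite gE fE cE mulmxA.
Qed.

Lemma mcm_idealI : mcm (idealI C I).
Proof.
by have [P HP] := gens_resolution; case=> // i _; exists P; exact: HP.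
Qed.

Lemma fin_gen_idealI : fin_gen (idealI C I).
Proof.
have gP (q : 'I_k) : x ^+ (k.-1 - q) * y ^+ i_ q \in gen_ideal (@idx_gens C k I).
  by rewrite -[_ * _]mul1r; apply: gen_ideal_mem; exists q.
exists [seq IdealMod (gP q) : M | q <- enum 'I_k] => -[m mG].
pose s := [seq IdealMod (gP q) : M | q <- enum 'I_k].
have sz : size s = k by rewrite size_map size_enum_ord.
suff [c cE] : exists c : 'I_k -> R, m = \sum_q c q * (x ^+ (k.-1 - q) * y ^+ i_ q).
  exists (c \o cast_ord sz); apply: val_inj; rewrite raddf_sum /= cE.
  rewrite (reindex (cast_ord sz)) /=; last first.
    by exists (cast_ord (esym sz)) => q _; rewrite ?cast_ordK ?cast_ordKV.
  apply: eq_bigr => i _; rewrite (nth_map (cast_ord sz i)) /=; last first.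
    by rewrite size_enum_ord; exact: (ltn_ord (cast_ord sz i)).
  congr (_ * _); rewrite (_ : nth _ _ _ = cast_ord sz i) //.
  by rewrite -[RHS](nth_ord_enum (cast_ord sz i)).
move: m mG; apply: gen_ideal_ind.
  by exists (fun=> 0); rewrite big1 // => q _; rewrite mul0r.
move=> a _ _ [q qk ->] [c ->].
exists (fun p => (if p == Ordinal qk then a else 0) + c p).
under [in RHS]eq_bigr => p _ do rewrite mulrDl.
rewrite big_split /= [X in _ = X + _](bigD1 (Ordinal qk)) //= eqxx.
rewrite [X in _ = _ + X + _]big1 ?addr0 // => p.
by move=> /negbTE ->; rewrite mul0r.
Qed.

End PeriodicResolution.

Lemma additive_pack (U V : zmodType) (f : U -> V) :
  {morph f : u v / u + v} -> exists g : {additive U -> V}, g =1 f.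
Proof.
move=> fD; have f0 : f 0 = 0 by apply: (addrI (f 0)); rewrite -fD !addr0.
have fB : zmod_morphism f.
  move=> u v; rewrite fD; congr (_ + _).
  by apply: (addrI (f v)); rewrite -fD !subrr.
pose m := GRing.isZmodMorphism.Build U V f fB.
by exists (HB.pack_for {additive U -> V} f m).
Qed.

(** * Rank and monomials of I *)

Section IdealsHaveRankOne.
Variables (C : fieldType) (k : nat) (I : idx k).
Hypothesis k_gt0 : (0 < k)%N.
Local Notation R := (ringR C k).
Local Notation F := (ringF C k).
Local Notation x := (xR C k).
Local Notation y := (yR C k).
Local Notation i_ := (idx_i I).
Local Notation M := (idealI C I).
Local Notation ideal_val := (@ideal_val _ (@idx_gens C k I)).

(** I contains a power of y, which is a unit of F; so u (x) f -> u f identifies I (x) F with F, with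
    inverse f -> y^(i_(k-1)) (x) w f, where w is the inverse of y^(i_(k-1)). *)
Lemma gen_free_idealI : gen_free 1 M.
Proof.
have gP : y ^+ i_ k.-1 \in gen_ideal (@idx_gens C k I).
  rewrite -[_ ^+ _]mul1r; apply: gen_ideal_mem; exists k.-1; first by rewrite prednK.
  by rewrite subnn expr0 mul1r.
have [w gw] := loc_yX_unit C k_gt0 (i_ k.-1).
pose t (m : M) (f : F) : 'rV[F]_1 := const_mx (loc (ideal_val m : R) * f).
exists (fun=> idx_tw I), t; split; last first.
  move=> d e m f mP fP s; rewrite mxE addrAC; apply: (partF_M k_gt0) => //.
  exact/(partF_loc k_gt0).
have tb : balanced t.
  split=> [m n f|m f g|r m f]; apply/rowP => s; rewrite !mxE.
  - by rewrite -mulrDl -locD.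
  - by rewrite mulrDr.
  - by rewrite [loc (ideal_val _)](locM k_gt0) mulrCA mulrA.
split=> //.
- by move=> m f g; apply/rowP => s; rewrite !mxE mulrCA.
- move=> U b bb; have [|h hE] := @additive_pack 'rV[F]_1 U (fun v => b (IdealMod gP) (w * v 0 0)).
    by move=> u v /=; rewrite !mxE mulrDr (balancedDr bb).
  exists h => m f; rewrite hE mxE.
  have mE : (ideal_val m : R) *: (IdealMod gP : M) = y ^+ i_ k.-1 *: m.
    by apply: val_inj; exact: mulrC.
  rewrite mulrCA -(balancedZ bb) mE (balancedZ bb) mulrA gw mul1r //.
move=> U h h' E z; suff -> : z = t (IdealMod gP) (w * z 0 0) by [].
by apply/rowP => s; rewrite ord1 mxE mulrA gw mul1r.
Qed.

Lemma mcm_rank1_idealI : mcm_rank1 M.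
Proof. by split; [exact: fin_gen_idealI | exact: mcm_idealI | exact: gen_free_idealI]. Qed.

(** The generator with index q contributes to x^a only if q >= k-1-a, and then i_q >= i_(k-1-a). *)
Lemma idx_ideal_coef (u : R) a b : u \in gen_ideal (@idx_gens C k I) ->
  (u : {poly {poly C}})`_a`_b != 0 -> (i_ (k.-1 - a) <= b)%N.
Proof.
have [ka|ak] := leqP k a; first by rewrite coef_qpoly_ge // coef0 eqxx.
move: u; apply: gen_ideal_ind => [|c _ u [q qk ->] IHu]; first by rewrite !coef0 eqxx.
rewrite mulrC -mulrA; set v : R := y ^+ _ * c.
rewrite [(_ + u : R)`_a]coefD coefD.
case: (eqVneq (u : {poly {poly C}})`_a`_b 0) => [-> |/IHu//].
rewrite addr0 coef_xXM //; case: ifP => [/andP[qa _]|_]; last first.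
  by rewrite coef0 eqxx.
rewrite /v coef_yXM // coefXnM; case: ltnP => [_|ib _]; first by rewrite eqxx.
by apply: leq_trans ib; apply: idx_i_mono; lia.
Qed.

Lemma mon_idx_ideal a b : (a < k)%N -> (i_ (k.-1 - a) <= b)%N ->
  x ^+ a * y ^+ b \in gen_ideal (@idx_gens C k I).
Proof.
move=> ak ib; rewrite -(subnK ib) exprD mulrCA; apply: gen_ideal_mem.
by exists (k.-1 - a)%N; [lia | congr (_ ^+ _ * _); lia].
Qed.

(* The piece of degree d of I is spanned by the x^(p-1) y^b of that degree with
   d <= l_p, and xy multiplies the monomial for p to the one for p+1. *)
Lemma ell_entry_ltP p (d : int) : (0 < p <= k)%N ->
  ell_entry I p < d <->
  (forall m : M, grpart M d m -> (x * y) ^+ (k - p) *: m = 0).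
Proof.
move=> pk; split=> [ltd m mP|nil].
  apply: val_inj; rewrite [LHS](_ : _ = (x * y) ^+ (k - p) * (ideal_val m : R)) //.
  apply: (qpolyXn_eqP k_gt0) => a ak; rewrite exprMn -mulrA coef_xXM // [RHS]coef0.
  case: ifP => // /andP[pa _].
  rewrite coef_yXM //; suff -> : (ideal_val m : {poly {poly C}})`_(a - (k - p)) = 0.
    by rewrite mulr0.
  apply/polyP => b; rewrite coef0; apply/eqP; apply: contraT => nz.
  have := mP _ _ nz; have := idx_ideal_coef (valP m) nz.
  have := @idx_i_mono k I (k - p) (k.-1 - (a - (k - p))).
  by move: ltd; rewrite /ell_entry; lia.
rewrite ltNge; apply/negP => dle; move: (dle); rewrite /ell_entry => dle'.
(* The monomial x^(p-1) y^b has degree d after the twist and lies in I as d <= l_p; (xy)^(k-p) sends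
   it to x^(k-1) times a power of y, which is nonzero. *)
have [b bE] : exists b : nat, b%:Z = p%:Z - 1 - d - idx_tw I.
  by exists (absz (p%:Z - 1 - d - idx_tw I)%R); lia.
have mP : x ^+ p.-1 * y ^+ b \in gen_ideal (@idx_gens C k I).
  apply: mon_idx_ideal; first by lia.
  by rewrite (_ : (k.-1 - p.-1 = k - p)%N); lia.
have mPd : grpart M d (IdealMod mP).
  have := @partR_mon C k p.-1 b; rewrite (_ : _ - _ = d + idx_tw I) //; lia.
have E : (x * y) ^+ (k - p) * (x ^+ p.-1 * y ^+ b) = 0 :> R.
  exact: (congr1 ideal_val (nil _ mPd)).
move/eqP: E; rewrite exprMn mulrACA -!exprD; apply/negP; apply: mon_neq0 => //; lia.
Qed.

End IdealsHaveRankOne.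

(** * Isomorphism classes of graded modules *)

Section GradedIsomorphisms.
Variables (C : fieldType) (k : nat).
Implicit Types M N P : grMod C k.

Lemma gr_iso_refl M : gr_iso M M.
Proof. by exists idfun; split; [exists idfun | move=> d m]. Qed.

Lemma gr_iso_sym M N : gr_iso M N -> gr_iso N M.
Proof.
move=> [f [[g fK gK] fP]].
have [|h hE] := @linear_pack _ N M g.
  by move=> a u v; apply: (can_inj fK); rewrite linearP /= !gK.
exists h; split; first by exists f => z; rewrite hE.
by move=> d m; rewrite hE fP gK.
Qed.

Lemma gr_iso_trans M N P : gr_iso M N -> gr_iso N P -> gr_iso M P.
Proof.
move=> [f [f_bij fP]] [g [g_bij gP]]; exists (g \o f); split; first exact: bij_comp.
by move=> d m; rewrite fP gP.
Qed.

Lemma iso_class_eq M N (MP : mcm_rank1 M) (NP : mcm_rank1 N) :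
  gr_iso M N -> iso_class MP = iso_class NP.
Proof.
move=> MN; apply: eq_exist; apply/funext => P; apply/propext.
by split; apply: gr_iso_trans => //; apply: gr_iso_sym.
Qed.

Lemma iso_class_inj M N (MP : mcm_rank1 M) (NP : mcm_rank1 N) :
  iso_class MP = iso_class NP -> gr_iso M N.
Proof. by move=> /(congr1 sval) /= ->; exact: gr_iso_refl. Qed.

(** By [ell_entry_ltP], whether l_p < d can be read off from the graded module, so an isomorphism
    preserves every l_p. *)
Lemma gr_iso_idealI (k_gt0 : (0 < k)%N) (I J : idx k) :
  gr_iso (idealI C I) (idealI C J) -> I = J.
Proof.
have le (I' J' : idx k) (p : nat) : gr_iso (idealI C I') (idealI C J') ->
    (0 < p <= k)%N -> ell_entry I' p <= ell_entry J' p.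
  move=> [f [f_bij fP]] pk; rewrite leNgt; apply/negP => /(@ell_entry_ltP C k _ k_gt0 p _ pk) nil.
  suff : ell_entry I' p < ell_entry I' p by rewrite ltxx.
  apply/(@ell_entry_ltP C k _ k_gt0 p _ pk) => m /fP /nil.
  by rewrite -linearZ => f0; apply: (bij_inj f_bij); rewrite f0 linear0.
move=> IJ; apply: ell_entry_inj => // p pk; apply/eqP; rewrite eq_le !le //.
exact: gr_iso_sym.
Qed.

End GradedIsomorphisms.

(** * Modules with vanishing Ext^1 are torsionless *)

Section Gradings.
Variables (C : fieldType) (k : nat) (M : lmodType (ringR C k)).
Variables (part : int -> M -> Prop) (gr : is_grading part).
Hypothesis k_gt0 : (0 < k)%N.
Local Notation R := (ringR C k).
Local Notation y := (yR C k).

Lemma gradingN d m : part d m -> part d (- m).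
Proof.
move=> mP; rewrite -scaleN1r -[d]add0r; apply: (gradingZ gr) => //.
exact: partRN (@partR1 C k).
Qed.

(** Collects summands of equal degree, since the independence of the pieces is stated for families
    indexed by distinct degrees. *)
Lemma grading_group (P : int -> Prop) (l : seq M) :
    (forall n, n \in l -> exists2 d, P d & part d n) ->
  exists (s : seq int) (c : int -> M),
    [/\ uniq s, forall d, d \in s -> P d, forall d, part d (c d)
      & \sum_(n <- l) n = \sum_(d <- s) c d].
Proof.
elim: l => [|n l IHl] Hl.
  exists [::], (fun=> 0); split=> // [d|]; last by rewrite !big_nil.
  exact: (grading0 gr).
have [|s [c [us sP cP E]]] := IHl.
  by move=> n' n'l; apply: Hl; rewrite in_cons n'l orbT.
have [d Pd nd] := Hl n (mem_head _ _).
have [ds|ds] := boolP (d \in s).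
  exists s, (fun e => c e + (if e == d then n else 0)); split=> // [e|].
    by apply: (gradingD gr) => //; case: eqP => [->|_] //; exact: (grading0 gr).
  rewrite big_cons E big_split /= addrC; congr (_ + _).
  by rewrite (bigD1_seq d) //= eqxx big1 ?addr0 // => e /negbTE ->.
exists (d :: s), (fun e => if e == d then n else c e); split=> /= [|e|e|].
- by rewrite ds.
- by rewrite in_cons => /orP[/eqP ->|/sP].
- by case: eqP => [->|_].
rewrite !big_cons eqxx E; congr (_ + _); apply: eq_big_seq => e es.
by case: eqP => // ed; rewrite -ed es in ds.
Qed.

Lemma grading_comps m : exists (s : seq int) (c : int -> M),
  [/\ uniq s, forall d, part d (c d) & m = \sum_(d <- s) c d].
Proof.
have [l [Hl ->]] := grading_decomp gr m.
have [|s [c [us _ cP E]]] := @grading_group (fun=> True) l; last by exists s, c.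
by move=> n /Hl [d dP]; exists d.
Qed.

(** Together with -m in degree e, the summands form a vanishing sum of homogeneous elements of
    distinct degrees, after grouping. *)
Lemma grading_eq0 e m (l : seq M) : part e m ->
  (forall n, n \in l -> exists2 d, d != e & part d n) -> m = \sum_(n <- l) n -> m = 0.
Proof.
move=> mP /(@grading_group (fun d => d != e)) [s [c [us sP cP ->]]] mE.
have es : e \notin s by apply/negP => /sP; rewrite eqxx.
apply/eqP; rewrite -oppr_eq0; apply/eqP.
have := @grading_indep _ _ _ _ gr (e :: s) (fun d => if d == e then - m else c d).
move=> /(_ _ _ _ e); rewrite eqxx; apply; last exact: mem_head.
- by rewrite /= es.
- by move=> d; case: eqP => [->|_] //; exact: gradingN.
- rewrite big_cons eqxx {1}mE addrC; apply/eqP; rewrite subr_eq0; apply/eqP.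
  by apply: eq_big_seq => d /sP /negbTE ->.
Qed.

Let spanned_below (D : int) m := exists l : seq M,
  (forall n, n \in l -> exists2 d, d < D & part d n) /\ m = \sum_(n <- l) n.

Let spanned_belowD D m n :
  spanned_below D m -> spanned_below D n -> spanned_below D (m + n).
Proof.
move=> [l [Hl ->]] [l' [Hl' ->]]; exists (l ++ l'); rewrite big_cat; split=> // z.
by rewrite mem_cat => /orP[/Hl|/Hl'].
Qed.

Let spanned_below0 D : spanned_below D 0.
Proof. by exists [::]; rewrite big_nil. Qed.

Let spanned_below_le D D' m : D <= D' -> spanned_below D m -> spanned_below D' m.
Proof.
move=> DD' [l [Hl ->]]; exists l; split=> // n /Hl [d dD dP].
by exists d => //; apply: lt_le_trans DD'.
Qed.

Let spanned_below_ex m : exists D, spanned_below D m.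
Proof.
have [l [Hl ->]] := grading_decomp gr m; elim: l Hl => [|n l IHl] Hl.
  by exists 0; rewrite big_nil; exact: spanned_below0.
have [|D HD] := IHl; first by move=> z zl; apply: Hl; rewrite in_cons zl orbT.
have [d dP] := Hl n (mem_head _ _).
exists (Num.max D (d + 1)); rewrite big_cons; apply: spanned_belowD.
  exists [:: n]; rewrite big_seq1; split=> // z; rewrite inE => /eqP ->.
  by exists d => //; rewrite lt_max ltrDl ltr01 orbT.
by apply: spanned_below_le HD; rewrite le_max lexx.
Qed.

Let spanned_belowZ D (r : R) m :
  spanned_below D m -> spanned_below (D + k%:Z) (r *: m).
Proof.
move=> [l [Hl ->]]; have [s [Hs ->]] := partR_decomp r.
elim: s Hs => [|c s IHs] Hs; first by rewrite big_nil scale0r.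
rewrite big_cons scalerDl; apply: spanned_belowD; last first.
  by apply: IHs => z zs; apply: Hs; rewrite in_cons zs orbT.
have [e eP] := Hs c (mem_head _ _).
have [->|c0] := eqVneq c 0; first by rewrite scale0r.
exists [seq c *: n | n <- l]; rewrite big_map scaler_sumr; split=> // _ /mapP[n /Hl[d dD dP] ->].
exists (e + d); last exact: (gradingZ gr).
by rewrite addrC ltrD // (partR_lt k_gt0 eP).
Qed.

(* x has degree 1 but is nilpotent, and y has degree -1. *)
Lemma grading_bounded : fin_gen M ->
  exists E, forall e m, E <= e -> part e m -> m = 0.
Proof.
move=> [s sM]; suff [E HE] : exists E, forall m, spanned_below E m.
  exists E => e m Ee mP; have [l [Hl mE]] := HE m.
  apply: (grading_eq0 mP) mE => n /Hl [d dE dP]; exists d => //.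
  by rewrite neq_lt (lt_le_trans dE Ee).
have [D HD] : exists D, forall m, m \in s -> spanned_below D m.
  elim: (s) => [|n l [D HD]]; first by exists 0.
  have [D' HD'] := spanned_below_ex n; exists (Num.max D D') => m.
  rewrite in_cons => /orP[/eqP ->|/HD].
    by apply: spanned_below_le HD'; rewrite le_max lexx orbT.
  by apply: spanned_below_le; rewrite le_max lexx.
exists (D + k%:Z) => m; have [c ->] := sM m.
elim/big_ind: _ => [||i _]; [exact: spanned_below0 | exact: spanned_belowD|].
by apply/spanned_belowZ/HD; rewrite mem_nth.
Qed.

(** If m = y^n u, then only the component of u in degree d + n can contribute to m, and for large n
    this degree exceeds the bound on the degrees of M. *)
Lemma homog_not_ydiv d m : fin_gen M -> part d m -> m != 0 ->
  exists n, forall u, m != y ^+ n *: u.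
Proof.
move=> /grading_bounded [E HE] mP m0.
have [n En] : exists n : nat, E <= d + n%:Z by exists (absz (E - d)%R); lia.
exists n => u; apply: contraNneq m0 => mE; apply/eqP.
have [l [Hl uE]] := grading_decomp gr u.
apply: (@grading_eq0 d m [seq y ^+ n *: v | v <- l]) => //; last first.
  by rewrite big_map -scaler_sumr -uE.
move=> _ /mapP[v /Hl[e vP] ->]; have [dE|de] := eqVneq (e - n%:Z) d.
  (* Here v has degree d + n >= E, so y^n v is 0 and may be assigned any degree other than d. *)
  exists (d + 1); first by rewrite -subr_eq0 addrAC subrr add0r oner_eq0.
  rewrite (HE _ _ _ vP) ?scaler0; first exact: (grading0 gr).
  by rewrite -dE subrK in En.
exists (e - n%:Z) => //; rewrite addrC; apply: (gradingZ gr) => //.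
by have := @partR_mon C k 0 n; rewrite mul1r sub0r.
Qed.

End Gradings.

(** * A linear form that vanishes on a subspace and not at a given vector *)

Section SeparatingFunctional.
Local Open Scope classical_set_scope.
Variables (K : fieldType) (A : nzRingType) (f : {rmorphism K -> A}) (V : lmodType A).
Implicit Types (u v w : V) (W : set V).

(** A maximal subspace D that contains W and misses v is a complement of the line spanned by v, and
    l is the coordinate along v. *)
Lemma separating_functional W v : W 0 ->
    (forall a u w, W u -> W w -> W (f a *: u + w)) -> ~ W v ->
  exists l : V -> K, [/\ forall a u w, l (f a *: u + w) = a * l u + l w,
    forall u, W u -> l u = 0 & l v = 1].
Proof.
move=> W0 WL Wv.
(* Zorn's lemma is applied to all chains, including the empty one, so [P] must hold for the empty
   set: stability under adding W replaces the inclusion of W in D. A maximal D is nonempty, since W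
   satisfies [P]. *)
pose P (D : set V) := [/\ forall a u w, D u -> D w -> D (f a *: u + w),
  forall u w, D u -> W w -> D (u + w) & ~ D v].
have [D [[DL DW Dv] Dmax]] : exists D, P D /\ forall B, D `<` B -> ~ P B.
  apply: Zorn_bigcup => F FP Ftot; split.
  - move=> a u w [X FX Xu] [Y FY Yw]; have [[XL _ _] [YL _ _]] := (FP _ FX, FP _ FY).
    by have [XY|YX] := Ftot _ _ FX FY; [exists Y => //; apply: YL => //; apply: XY
      | exists X => //; apply: XL => //; apply: YX].
  - by move=> u w [X FX Xu] Ww; exists X => //; have [_ XW _] := FP _ FX; exact: XW.
  - by move=> [X FX Xv]; have [_ _] := FP _ FX.
have Dmax' (B : set V) : P B -> D `<=` B -> B `<=` D.
  by move=> PB DB; apply: contrapT => BD; apply: (Dmax B).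
have WP : P W by split=> // u w Wu Ww; rewrite -[u]scale1r -(rmorph1 f); exact: WL.
have D0 : D 0.
  have [[u Du]|D_empty] := pselect (exists u, D u).
    by have := DL (- 1) u u Du Du; rewrite rmorphN1 scaleN1r addNr.
  by apply: (Dmax' W WP) => // u Du; case: D_empty; exists u.
have WD w : W w -> D w by move=> Ww; rewrite -[w]add0r; exact: DW.
have DZ a u : D u -> D (f a *: u) by move=> Du; rewrite -[_ *: _]addr0; exact: DL.
have DB u w : D u -> D w -> D (u - w).
  by move=> Du Dw; rewrite addrC -scaleN1r -(rmorphN1 f); exact: DL.
have dec u : exists c, D (u - f c *: v).
  have [Du|Du] := pselect (D u); first by exists 0; rewrite rmorph0 scale0r subr0.
  (* [B] is D + K u. By maximality it contains v, so v - a u lies in D with a nonzero, and dividing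
     by a decomposes u. *)
  pose B : set V := [set z | exists a, D (z - f a *: u)].
  have [[a Da]|Bv] := pselect (B v).
    have a0 : a != 0.
      by apply/eqP => a0; move: Da; rewrite a0 rmorph0 scale0r subr0.
    exists a^-1; have := DZ (- a^-1) _ Da.
    by rewrite scalerBr scalerA -rmorphM mulNr mulVf // rmorphN1 scaleN1r opprK
      rmorphN scaleNr addrC.
  case: Du; apply: (Dmax' B) => [|z Dz|]; first split=> //.
  - move=> a z w [b Db] [c Dc]; exists (a * b + c); have := DL a _ _ Db Dc.
    by rewrite scalerBr scalerA -rmorphM addrACA -opprD -scalerDl -rmorphD.
  - by move=> z w [b Db] Ww; exists b; rewrite addrAC; exact: DW.
  - by exists 0; rewrite rmorph0 scale0r subr0.
  - by exists 1; rewrite rmorph1 scale1r subrr.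
have uniq_c u c c' : D (u - f c *: v) -> D (u - f c' *: v) -> c = c'.
  move=> Dc Dc'; apply/eqP; rewrite -subr_eq0; apply: contrapT => /negP cc'.
  apply: Dv; have := DZ (c - c')^-1 _ (DB _ _ Dc' Dc).
  have -> : (u - f c' *: v) - (u - f c *: v) = f (c - c') *: v.
    by rewrite opprB [LHS]addrC addrA subrK -scalerBl -rmorphB.
  by rewrite scalerA -rmorphM mulVf // rmorph1 scale1r.
have [l lP] := choice dec; exists l; split=> [a u w|u Wu|].
- apply: (uniq_c (f a *: u + w)) => //; have := DL a _ _ (lP u) (lP w).
  by rewrite scalerBr scalerA -rmorphM addrACA -opprD -scalerDl -rmorphD.
- by apply: (uniq_c u) => //; rewrite rmorph0 scale0r subr0; exact: WD.
- by apply: (uniq_c v) => //; rewrite rmorph1 scale1r subrr.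
Qed.

End SeparatingFunctional.

(** * Lifting maps to R/(y^n) along R -> R/(y^n) *)

Section LiftingModuloYn.
Variables (C : fieldType) (k : nat) (M : lmodType (ringR C k)) (n : nat).
Hypothesis k_gt0 : (0 < k)%N.
Local Notation R := (ringR C k).
Local Notation x := (xR C k).
Local Notation y := (yR C k).

(* R-linear maps M -> R/(y^n), given by a set-theoretic lift to R. *)
Record linear_mod := LinearMod {
  linear_mod_fun :> M -> R;
  linear_modP : forall r u v, exists w,
    linear_mod_fun (r *: u + v) = r * linear_mod_fun u + linear_mod_fun v + y ^+ n * w }.

(** The fibre product of M and R over R/(y^n). *)
Definition pullback_pred (Phi : linear_mod) : pred (M * R^o)%type :=
  fun z => `[< exists w, z.2 = Phi z.1 + y ^+ n * w :> R >].

Lemma pullback_submod Phi : GRing.submod_closed (pullback_pred Phi).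
Proof.
split=> [|r z z' /asboolP[w wE] /asboolP[w' wE']]; apply/asboolP.
  have [w] := linear_modP Phi (- 1) 0 0; rewrite scaler0 addr0 mulN1r addNr add0r => E.
  by exists (- w); rewrite /= E mulrN subrr.
have [v vE] := linear_modP Phi r z.1 z'.1; exists (r * w + w' - v).
rewrite /= vE wE wE' -[r *: _]/(r * (_ : R)) mulrBr 2!mulrDr mulrCA.
rewrite [RHS]addrACA subrr addr0 addrACA.
by congr (_ + _); rewrite addrC.
Qed.

HB.instance Definition _ (Phi : linear_mod) :=
  GRing.isSubmodClosed.Build R (M * R^o)%type (pullback_pred Phi) (pullback_submod Phi).

Record pullback (Phi : linear_mod) := Pullback {
  pullback_val :> (M * R^o)%type;
  _ : pullback_val \in pullback_pred Phi }.

HB.instance Definition _ Phi := [isSub for @pullback_val Phi].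
HB.instance Definition _ Phi := [Choice of pullback Phi by <:].
HB.instance Definition _ Phi := [SubChoice_isSubLmodule of pullback Phi by <:].

(** This is the long exact sequence of 0 -> R -> R -> R/(y^n) -> 0, made explicit. Projectivity of
    P_0 gives a map G from P_0 to R over Phi. On the image of P_1 it is y^n H with H a cocycle; as H
    = g d, the map G - y^n g descends to M. *)
Lemma ext1_lift (Phi : linear_mod) : ext_zero 1 M R^o ->
  exists psi : {linear M -> R^o}, forall u, exists w, psi u = Phi u + y ^+ n * w :> R.
Proof.
move=> [P extP].
have [|pr1 pr1E] := @linear_pack R (pullback Phi) M (fun z => (val z).1); first by [].
have pr1_surj u : exists z, pr1 z = u.
  have uP : (u, Phi u : R^o) \in pullback_pred Phi.
    by apply/asboolP; exists 0; rewrite mulr0 addr0.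
  by exists (Pullback uP); rewrite pr1E.
have [h hE] := @res_proj _ _ P 0%N _ _ pr1 (res_aug P) pr1_surj.
have [|G GE] := @linear_pack R (P 0%N) R^o (fun p => (val (h p)).2).
  by move=> a u v; rewrite linearP.
have GPhi p : exists w, G p = Phi (res_aug P p) + y ^+ n * w :> R.
  by rewrite GE -hE pr1E; case: (h p) => z zP; exact/asboolP.
have Phi0 : exists w, Phi 0 = y ^+ n * w.
  have [w] := linear_modP Phi (- 1) 0 0; rewrite scaler0 addr0 mulN1r addNr add0r => ->.
  by exists w.
have Gd q : exists w : R, G (res_d P 0 q) = y ^+ n * w :> R.
  have [w ->] := GPhi (res_d P 0 q); have [w0 w0E] := Phi0.
  rewrite (proj2 (res_exact0 _)); last by exists q.
  by exists (w0 + w); rewrite w0E mulrDr.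
have [H' H'E] := choice Gd.
have [|H HE] := @linear_pack R (P 1%N) R^o H'.
  move=> a u v; apply: (@yRX_inj _ _ k_gt0 n); rewrite /= -H'E !linearP /=.
  by rewrite !H'E mulrDr; congr (_ + _); exact: mulrCA.
have [q|g gE] := extP H.
  apply: (@yRX_inj _ _ k_gt0 n); rewrite /= mulr0 HE -H'E.
  by rewrite (proj2 (res_exact _)) ?linear0 //; exists q.
have [|D DE] := @linear_pack R (P 0%N) R^o (fun p => (G p : R) - y ^+ n * (g p : R)).
  move=> a u v; have GL : G (a *: u + v) = a * (G u : R) + (G v : R) by exact: linearP.
  have gL : g (a *: u + v) = a * (g u : R) + (g v : R) by exact: linearP.
  rewrite GL gL [RHS](_ : _ = a * ((G u : R) - y ^+ n * (g u : R)) +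
    ((G v : R) - y ^+ n * (g v : R))) //.
  by rewrite mulrBr mulrDr opprD addrACA mulrCA.
have D0 p : res_aug P p = 0 -> D p = 0.
  move=> /res_exact0[q <-]; rewrite DE H'E -gE HE; exact: subrr.
have [s sE] := choice (res_surj P).
have DP p p' : res_aug P p = res_aug P p' -> D p = D p'.
  move=> /eqP; rewrite -subr_eq0 -linearB => /eqP /D0 /eqP.
  by rewrite linearB subr_eq0 => /eqP.
have [|psi psE] := @linear_pack R M R^o (fun u => D (s u)).
  by move=> a u v; rewrite (DP _ (a *: s u + s v)) !linearP //= !sE.
exists psi => u; have [w wE] := GPhi (s u); rewrite psE DE wE sE.
by exists (w - g (s u)); rewrite mulrBr addrA.
Qed.

End LiftingModuloYn.

(** * Linear forms that do not kill a given homogeneous element *)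

Section Torsionless.
Variables (C : fieldType) (k : nat) (M : lmodType (ringR C k)).
Hypothesis k_gt0 : (0 < k)%N.
Local Notation R := (ringR C k).
Local Notation x := (xR C k).
Local Notation y := (yR C k).
Local Notation cst := (qpolyC ('X^k : {poly {poly C}}) : {poly C} -> R).

(** C, x and y generate R as a ring, so linearity modulo y^n need only be checked on them. *)
Lemma ringR_ind (P : R -> Prop) :
    (forall r s, P r -> P s -> P (r + s)) -> (forall r s, P r -> P s -> P (r * s)) ->
    (forall c : C, P (cst c%:P)) -> P x -> P y -> forall r, P r.
Proof.
move=> PD PM Pc Px Py r.
have P0 : P 0 by have := Pc 0; rewrite !rmorph0.
have P1 : P 1 by have := Pc 1; rewrite !rmorph1.
rewrite (qpoly_sumE k_gt0 r); apply: (big_ind P) => [||a _] //; apply: (PM).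
  elim/poly_ind: (_`_a) => [|p c IHp]; first by rewrite rmorph0.
  rewrite rmorphD rmorphM; apply: (PD); last exact: Pc.
  by apply: (PM); [exact: IHp | have := Py; rewrite (yR_E C k_gt0)].
by elim: (a : nat) => [|b IHb]; rewrite ?expr0 // exprS; apply: (PM).
Qed.

Section DualMap.
Variables (n : nat) (l : M -> C).
Hypothesis lL : forall c u v, l (cst c%:P *: u + v) = c * l u + l v.
Hypothesis ly : forall u, l (y ^+ n *: u) = 0.

(* R/(y^n) is a Frobenius algebra: a C-linear form l on a module killed by y^n
   induces an R-linear map to R/(y^n). *)
Let Phi (u : M) : R := in_qpoly 'X^k
  (\poly_(a < k) \poly_(b < n) l ((x ^+ (k.-1 - a) * y ^+ (n.-1 - b)) *: u)).

Let PhiE u a b : (Phi u : {poly {poly C}})`_a`_b =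
  if (a < k)%N && (b < n)%N then l ((x ^+ (k.-1 - a) * y ^+ (n.-1 - b)) *: u) else 0.
Proof.
rewrite coef_in_qpoly // coef_poly; case: (ltnP a k) => ak /=; last by rewrite coef0.
by rewrite coef_poly.
Qed.

Let PhiD u v : Phi (u + v) = Phi u + Phi v.
Proof.
apply: (qpolyXn_eqP k_gt0) => a ak; apply/polyP => b.
rewrite [(_ + _ : R)`_a]coefD coefD !PhiE; case: ifP => _; last by rewrite addr0.
have lD v' w' : l (v' + w') = l v' + l w'.
  by have := lL 1 v' w'; rewrite !rmorph1 scale1r mul1r.
by rewrite scalerDr lD.
Qed.

Let l0 : l 0 = 0.
Proof. by have := ly 0; rewrite scaler0. Qed.

Let lZ c u : l (cst c%:P *: u) = c * l u.
Proof. by have := lL c u 0; rewrite l0 !addr0. Qed.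

Let PhiZ r u : exists w, Phi (r *: u) = r * Phi u + y ^+ n * w.
Proof.
move: r u; apply: ringR_ind => [r s Pr Ps u|r s Pr Ps u|c u|u|u].
- have [[w wE] [w' wE']] := (Pr u, Ps u); exists (w + w').
  by rewrite scalerDl PhiD wE wE' mulrDl mulrDr addrACA.
- have [w wE] := Ps u; have [w' wE'] := Pr (s *: u); exists (r * w + w').
  by rewrite -scalerA wE' wE !mulrDr mulrA mulrCA addrA.
- exists 0; rewrite mulr0 addr0; apply: (qpolyXn_eqP k_gt0) => a ak; apply/polyP => b.
  rewrite coef_qpolyCM // coefCM !PhiE; case: ifP => _; last by rewrite mulr0.
  rewrite scalerA mulrC -lZ; congr (l _); exact/esym/scalerA.
- exists 0; rewrite mulr0 addr0; apply: (qpolyXn_eqP k_gt0) => a ak; apply/polyP => b.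
  rewrite -[x in RHS]expr1 coef_xXM // PhiE scalerA mulrAC -exprSr.
  case: (posnP a) => [->|a0].
    by rewrite subn0 prednK // qpolyX_nilp // mul0r scale0r l0 coef0 if_same.
  rewrite ak PhiE (leq_ltn_trans (leq_subr _ _) ak) /=; case: ifP => // _.
  by congr (l ((x ^+ _ * _) *: _)); lia.
(* For r = y the two sides agree below y^n, as l kills multiples of y^n. The product y Phi(u) has
   the additional terms l(x^(k-1-a) u) x^a y^n, which [w] removes. *)
have [w wE] : exists w : R, forall a, (a < k)%N ->
    (w : {poly {poly C}})`_a = (- l (x ^+ (k.-1 - a) *: u))%:P.
  exists (in_qpoly 'X^k (\poly_(a < k) (- l (x ^+ (k.-1 - a) *: u))%:P)) => a ak.
  by rewrite coef_in_qpoly // ak coef_poly ak.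
exists w; apply: (qpolyXn_eqP k_gt0) => a ak; apply/polyP => b.
rewrite [(_ + _ : R)`_a]coefD coefD -[y in RHS]expr1 !coef_yXM // wE //.
rewrite !coefXnM coefC !PhiE ak /= scalerA -mulrA -exprSr.
have lyx z : l ((z * y ^+ n) *: u) = 0 by rewrite mulrC -scalerA ly.
case: (posnP n) => [n0|n0].
  by have l00 z : l z = 0; [rewrite -[z]scale1r -(expr0 y) -n0 | rewrite !l00 oppr0 !if_same addr0].
case: (ltngtP b n) => [bn|nb|->].
- rewrite addr0; case: (posnP b) => [->|b0]; first by rewrite subn0 prednK ?lyx.
  by rewrite ifF ?ifT; [congr (l ((_ * y ^+ _) *: _)) | |]; lia.
- by rewrite ifF ?[X in X + _]ifF ?[X in _ + X]ifF ?addr0 //; lia.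
rewrite subnn eqxx ifF ?ifT; [|lia|lia].
by rewrite (_ : (n.-1 - (n - 1) = 0)%N) ?expr0 ?mulr1 ?subrr //; lia.
Qed.

(** The form l is recovered as the coefficient of x^(k-1) y^(n-1), a generator of the socle of
    R/(y^n). *)
Lemma dual_map : (0 < n)%N -> exists Phi' : linear_mod M n,
  forall u, (Phi' u : {poly {poly C}})`_k.-1`_n.-1 = l u.
Proof.
move=> n_gt0; have PhiP r u v : exists w, Phi (r *: u + v) = r * Phi u + Phi v + y ^+ n * w.
  by have [w wE] := PhiZ r u; exists w; rewrite PhiD wE addrAC.
exists (LinearMod PhiP) => u.
by rewrite PhiE !ltn_predL k_gt0 n_gt0 !subnn mul1r scale1r.
Qed.

End DualMap.

Lemma torsionless (part : int -> M -> Prop) d m :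
    is_grading part -> fin_gen M -> ext_zero 1 M R^o -> part d m -> m != 0 ->
  exists psi : {linear M -> R^o}, psi m != 0.
Proof.
move=> gr Mfg ext mP m0; have [n nP] := homog_not_ydiv gr k_gt0 Mfg mP m0.
have n_gt0 : (0 < n)%N.
  by rewrite lt0n; apply: contraTneq (nP m) => ->; rewrite expr0 scale1r eqxx.
pose f : {rmorphism C -> R} := qpolyC ('X^k : {poly {poly C}}) \o polyC.
have [|a u w [z ->] [z' ->]||l [lL lW lm]] :=
    @separating_functional C R f M (fun u => exists z, u = y ^+ n *: z) m.
- by exists 0; rewrite scaler0.
- by exists (f a *: z + z'); rewrite scalerDr !scalerA [y ^+ n * _]mulrC.
- by move=> [z mE]; have := nP z; rewrite -mE eqxx.
have ly u : l (y ^+ n *: u) = 0 by apply: lW; exists u.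
have [Phi PhiE] := dual_map lL ly n_gt0.
have [psi psiE] := ext1_lift k_gt0 Phi ext.
exists psi; apply/eqP => psi0; have [w] := psiE m; rewrite psi0 => /esym E.
(* Multiples of y^n do not affect the coefficient of x^(k-1) y^(n-1), which is l m = 1 in
   [Phi m]. *)
have := congr1 (fun r : R => (r : {poly {poly C}})`_k.-1`_n.-1) E.
rewrite [(_ + _ : R)`_k.-1]coefD coefD PhiE lm coef_yXM // coefXnM prednK // leqnn.
by rewrite addr0 !coef0 => /eqP; rewrite oner_eq0.
Qed.

End Torsionless.

(** * Classification *)

Section Embedding.
Variables (C : fieldType) (k : nat) (M : grMod C k).
Hypothesis k_gt0 : (0 < k)%N.
Local Notation R := (ringR C k).
Local Notation F := (ringF C k).
Local Notation x := (xR C k).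
Local Notation y := (yR C k).

Lemma homog_inj (f : {linear M -> R^o}) s :
    (forall d m, grpart M d m -> partR (d + s) (f m : R)) ->
    (forall d m, grpart M d m -> f m = 0 -> m = 0) -> injective f.
Proof.
move=> fP f0 u v /eqP; rewrite -subr_eq0 -linearB => /eqP.
move: (u - v) (subr0_eq (x := u) (y := v)) => m mE fm; apply: mE.
have [l [c [ul cP mE]]] := grading_comps (grP M) m; rewrite mE.
apply: big1_seq => d /= dl; apply: (f0 d) => //.
have := @partR_indep _ _ [seq e + s | e <- l] (fun e => f (c (e - s)) : R).
move=> /(_ _ _ _ (d + s)); rewrite addrK; apply.
- by rewrite map_inj_uniq //; apply: addIr.
- by move=> e; have := fP _ _ (cP (e - s)); rewrite subrK.
- rewrite big_map -[RHS]fm mE linear_sum; apply: eq_bigr => e _.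
  by rewrite addrK.
- exact: (map_f (+%R^~ s)).
Qed.

(** Split m into its part of degree d and the rest. The image of the rest is homogeneous of degree d
    + s but is a sum of elements of other degrees, hence 0. *)
Lemma homog_reflect (f : {linear M -> R^o}) s :
    (forall d m, grpart M d m -> partR (d + s) (f m : R)) -> injective f ->
  forall d m, partR (d + s) (f m : R) -> grpart M d m.
Proof.
move=> fP f_inj d m fmP.
have [l [c [ul cP mE]]] := grading_comps (grP M) m.
pose m0 := \sum_(e <- l | e == d) c e; pose m1 := \sum_(e <- l | e != d) c e.
have m0P : grpart M d m0.
  rewrite /m0; elim/big_ind: _ => [||e /eqP <-] //; first exact: (grading0 (grP M)).
  exact: (gradingD (grP M)).
have mE' : m = m0 + m1 by rewrite mE (bigID (fun e => e == d)).
suff m10 : m1 = 0 by rewrite mE' m10 addr0.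
apply: f_inj; rewrite linear0; apply: (qpolyXn_eqP k_gt0) => a _; apply/polyP => b.
rewrite [RHS](_ : _ = 0); last by rewrite !coef0.
apply/eqP; apply: contraT => nz.
have m1P : partR (d + s) (f m1 : R).
  have -> : f m1 = (f m : R) - (f m0 : R) by rewrite mE' linearD [RHS]addrAC subrr add0r.
  by apply: partRD => //; apply: partRN; exact: fP.
have abE := m1P a b nz.
suff : (f m1 : {poly {poly C}})`_a`_b = 0 by move=> E; rewrite E eqxx in nz.
rewrite linear_sum raddf_sum !coef_sum; apply: big1 => e ed.
apply/eqP; apply: contraT => nze; have := fP _ _ (cP e) a b nze.
by rewrite abE => /addIr de; rewrite de eqxx in ed.
Qed.

(** The last clause says that some image has a nonzero coefficient at x^0; this later puts a power
    of y into the image. *)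
Lemma mcm_rank1_embedding : mcm_rank1 M ->
  exists (f : {linear M -> R^o}) (s : int),
    [/\ injective f, forall d m, grpart M d m -> partR (d + s) (f m : R)
      & exists m, x ^+ k.-1 * (f m : R) != 0].
Proof.
move=> [Mfg Mmcm [j [t [[tb ts tex tuniq] tgr]]]].
pose i0 m : F := t m 1 0 0.
have tE m f : t m f = f *: t m 1 by rewrite -ts mulr1.
have i0D m n : i0 (m + n) = i0 m + i0 n by rewrite /i0 (balancedDl tb) mxE.
have i0Z r m : i0 (r *: m) = loc r * i0 m.
  by rewrite /i0 (balancedZ tb) mulr1 tE mxE.
have i0_inj d m : grpart M d m -> i0 m = 0 -> m = 0.
  move=> mP m0; apply/eqP; apply: contraT => mn0.
  have [psi psim] := torsionless k_gt0 (grP M) Mfg (Mmcm 1%N isT) mP mn0.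
  (* A linear form psi extends to m (x) f -> psi(m) f, so psi(m) != 0 forces m (x) 1 != 0. *)
  have [|h hE] := tex F (fun m f => loc (psi m : R) * f).
    split=> [m1 m2 f|m1 f g|r m1 f].
    - by rewrite linearD locD // mulrDl.
    - by rewrite mulrDr.
    - have -> : psi (r *: m1) = r * (psi m1 : R) :> R by exact: linearZ_LR.
      by rewrite locM // mulrCA mulrA.
  have := hE m 1; have -> : t m 1 = 0 by apply/rowP => z; rewrite ord1 mxE.
  rewrite raddf0 mulr1 -(@loc0 C k k_gt0) => /(loc_inj k_gt0) E.
  by rewrite -E eqxx in psim.
have denom : exists N, forall m, exists r : R, loc (y ^+ N) * i0 m = loc r.
  have [s sM] := Mfg.
  have [N HN] : exists N, forall m, m \in s -> exists r : R, loc (y ^+ N) * i0 m = loc r.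
    elim: (s) => [|m l [N HN]]; first by exists 0%N.
    have [n [r rE]] := loc_surj k_gt0 (i0 m).
    exists (n + N)%N => m'; rewrite in_cons exprD => /orP[/eqP ->|/HN [r' rE']].
      by exists (y ^+ N * r); rewrite !locM // -rE mulrCA mulrA.
    by exists (y ^+ n * r'); rewrite !locM // -rE' mulrA.
  exists N => m; have [c ->] := sM m.
  elim/big_ind: _ => [||i _].
  - by exists 0; rewrite -(scale0r 0) i0Z loc0 // mul0r mulr0.
  - by move=> u v [r rE] [r' rE']; exists (r + r'); rewrite i0D mulrDr rE rE' locD.
  - have [|r rE] := HN s`_i; first by rewrite mem_nth.
    by exists (c i * r); rewrite i0Z mulrCA rE locM.
have [N HN] := denom; have [f fE] := choice HN.
have [w yw] := loc_yX_unit C k_gt0 N.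
have yreg u : loc (y ^+ N) * u = 0 -> u = 0.
  by move=> u0; rewrite -[u]mul1r -yw mulrAC u0 mul0r.
have [|g gE] := @linear_pack R M R^o f.
  move=> a u v; apply: (loc_inj k_gt0).
  rewrite [RHS](_ : _ = loc (a * f u + f v)) // locD // locM //.
  by rewrite -!fE i0D i0Z mulrDr mulrCA.
have gP d m : grpart M d m -> partR (d + (j 0 - N%:Z)) (g m : R).
  move=> mP; apply/(partF_loc k_gt0); rewrite gE -fE addrA addrC.
  apply: (partF_M k_gt0).
    by apply/(partF_loc k_gt0); have := @partR_mon C k 0 N; rewrite mul1r sub0r.
  have := tgr d 0 m 1 mP; rewrite addr0; apply.
  by rewrite -(loc1 C k_gt0); apply/(partF_loc k_gt0); exact: partR1.
exists g, (j 0 - N%:Z); split=> //.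
  apply: homog_inj gP _ => d m mP gm0; apply: (i0_inj d) => //; apply: yreg.
  by rewrite fE -gE gm0 loc0.
apply: contrapT => noM.
have xi0 m : loc (x ^+ k.-1) * i0 m = 0.
  apply: yreg; rewrite mulrCA fE -gE -locM //.
  suff -> : x ^+ k.-1 * (g m : R) = 0 by rewrite loc0.
  by apply: contrapT => /eqP nz; apply: noM; exists m.
(* If x^(k-1) killed the image, then the identity and multiplication by 1 + x^(k-1) would agree on
   all m (x) f, hence on F, and x^(k-1) would be 0. *)
have [|h hE] := @additive_pack 'rV[F]_1 'rV[F]_1 (fun v => v + loc (x ^+ k.-1) *: v).
  by move=> u v; rewrite scalerDr addrACA.
have := tuniq _ idfun h _ (const_mx 1); rewrite hE /= => E.
have : loc (x ^+ k.-1) = 0.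
  have /rowP/(_ 0) : const_mx 1 = const_mx 1 + loc (x ^+ k.-1) *: const_mx 1 :> 'rV[F]_1.
    apply: E => m r; rewrite hE tE scalerA mulrC -scalerA.
    suff -> : loc (x ^+ k.-1) *: t m 1 = 0 by rewrite scaler0 addr0.
    by apply/rowP => z; rewrite ord1 !mxE xi0.
  by rewrite !mxE mulr1 -[LHS]addr0 => /addrI <-.
rewrite -(@loc0 C k k_gt0) => /(loc_inj k_gt0) /eqP.
rewrite -[_ ^+ _]mulr1 -(expr0 y); apply/negP; apply: mon_neq0 => //.
by rewrite ltn_predL.
Qed.

End Embedding.

(** * Monomials in homogeneous ideals *)

Section MonomialIdeals.
Variables (C : fieldType) (k : nat).
Hypothesis k_gt0 : (0 < k)%N.
Local Notation R := (ringR C k).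
Local Notation x := (xR C k).
Local Notation y := (yR C k).
Local Notation cst := (qpolyC ('X^k : {poly {poly C}}) : {poly C} -> R).

(* u = x^a0 y^b0 (c + xy w) with c <> 0, and xy is nilpotent. *)
Lemma homog_lowest_mon d (u : R) a0 b0 : partR d u ->
    (u : {poly {poly C}})`_a0`_b0 != 0 ->
    (forall a, (a < a0)%N -> (u : {poly {poly C}})`_a = 0) ->
  exists v, v * u = x ^+ a0 * y ^+ b0.
Proof.
move=> uP nz low; set c := _`_b0 in nz.
have dE := uP _ _ nz.
(* By homogeneity every monomial of u is x^(a0+j) y^(b0+j) for some j; the terms with j > 0 make up
   [w]. *)
pose w : R := in_qpoly 'X^k (\poly_(i < k)
  (((u : {poly {poly C}})`_(a0 + i.+1)`_(b0 + i.+1))%:P * 'X^i)).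
have uE : u = x ^+ a0 * (y ^+ b0 * (cst c%:P + x * (y * w))).
  apply: (qpolyXn_eqP k_gt0) => a ak; rewrite coef_xXM // ak andbT.
  case: (ltngtP a0 a) => [a0a|aa0|<-]; last 2 first.
  - exact: low.
  - rewrite subnn coef_yXM // [(_ + _ : R)`_0]coefD -[x in X in _ + X]expr1 coef_xXM //.
    rewrite addr0 coefC eqxx; apply/polyP => b; rewrite mulrC coefMXn.
    have [bb0|b0b] := ltnP b b0; last first.
      rewrite coefC subn_eq0; case: leqP => [bb0|bb0].
        by congr (_`_ _); lia.
      by apply/eqP; apply: contraT => /uP; lia.
    by apply/eqP; apply: contraT => /uP; lia.
  rewrite coef_yXM // [(_ + _ : R)`_(a - a0)]coefD -[x in X in _ + X]expr1 coef_xXM //.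
  rewrite coefC ifF ?add0r ?ifT; [|lia|lia]; rewrite -[y]expr1 coef_yXM //.
  rewrite coef_in_qpoly // ifT; last by lia.
  rewrite coef_poly ifT; last by lia.
  rewrite mulrA -exprSr; apply/polyP => b; rewrite coefXnM.
  case: ltnP => bb; first by apply/eqP; apply: contraT => /uP; lia.
  rewrite coefCM coefXn; have -> : (a0 + (a - a0 - 1).+1 = a)%N by lia.
  case: eqP => bE; first by rewrite mulr1; congr (_`_ _); lia.
  by rewrite mulr0; apply/eqP; apply: contraT => /uP; lia.
have nilp : (- (x * (y * w))) ^+ k = 0.
  by rewrite exprNn exprMn qpolyX_nilp // mul0r mulr0.
(* With t = xyw nilpotent, c^k = c^k - (-t)^k = (c + t) S, so c^(-k) S is the inverse of c + t. *)
have := subrXX (cst c%:P) (- (x * (y * w))) k; rewrite nilp subr0 opprK.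
set S := \sum_(i < k) _ => SE; exists (cst (c ^- k)%:P * S).
have inv : cst (c ^- k)%:P * S * (cst c%:P + x * (y * w)) = 1.
  rewrite -mulrA [S * _]mulrC -SE -rmorphXn -rmorphM -polyC_exp -polyCM.
  by rewrite mulVf ?expf_neq0 // !rmorph1.
by rewrite {1}uE [x ^+ _ * (_ * _)]mulrA mulrCA inv mulr1.
Qed.

Variable J : R -> Prop.
Hypothesis JM : forall r u, J u -> J (r * u).

(** J contains the lowest monomial of u, and the other monomials of the same degree are its
    multiples by powers of xy. *)
Lemma homog_mon_mem d (u : R) a b : partR d u -> J u ->
  (u : {poly {poly C}})`_a`_b != 0 -> J (x ^+ a * y ^+ b).
Proof.
move=> uP Ju nz.
have ex_a : exists a', (u : {poly {poly C}})`_a' != 0.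
  by exists a; apply: contraNneq nz => ->; rewrite coef0.
case: (ex_minnP ex_a) => a0 nza0 a0_min.
have [b0 nz0] : exists b0, (u : {poly {poly C}})`_a0`_b0 != 0.
  by exists (size (u : {poly {poly C}})`_a0).-1; rewrite -lead_coefE lead_coef_eq0.
have [a' a'a0|v vE] := homog_lowest_mon uP nz0.
  by apply/eqP; apply: contraTT a'a0 => /a0_min; rewrite -leqNgt.
have a0a : (a0 <= a)%N by apply: a0_min; apply: contraNneq nz => ->; rewrite coef0.
have [dE dE0] := (uP _ _ nz, uP _ _ nz0).
have b0b : (b0 <= b)%N by lia.
have ab0 : (b - b0 = a - a0)%N by lia.
have -> : x ^+ a * y ^+ b = (x ^+ (a - a0) * y ^+ (b - b0) * v) * u.
  by rewrite -mulrA vE mulrACA -!exprD !subnK.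
exact: JM.
Qed.

End MonomialIdeals.

(** * Every module in question is some I *)

Section Classification.
Variables (C : fieldType) (k : nat) (M : grMod C k).
Hypothesis k_gt0 : (0 < k)%N.
Local Notation R := (ringR C k).
Local Notation x := (xR C k).
Local Notation y := (yR C k).
Local Notation cst := (qpolyC ('X^k : {poly {poly C}}) : {poly C} -> R).

(* The image J of M in R is spanned over C[y] by the x^a y^(beta a). *)
Lemma mcm_rank1_ideal : mcm_rank1 M -> exists I : idx k, gr_iso M (idealI C I).
Proof.
move=> /(mcm_rank1_embedding k_gt0) [f [s [f_inj fP [m0 m0P]]]].
pose J (u : R) := exists m, f m = u.
have fE a u v : f (a *: u + v) = a * (f u : R) + (f v : R) by exact: linearP.
have JM r u : J u -> J (r * u) by move=> [m <-]; exists (r *: m); exact: linearZ_LR.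
have JD u v : J u -> J v -> J (u + v).
  by move=> [m <-] [n <-]; exists (m + n); exact: linearD.
have J_mon u a b : J u -> (u : {poly {poly C}})`_a`_b != 0 -> J (x ^+ a * y ^+ b).
  move=> [m <-]; have [l [c [_ cP ->]]] := grading_comps (grP M) m => nz.
  have [d nzd] : exists d, (f (c d) : {poly {poly C}})`_a`_b != 0.
    apply: contrapT => all0; case/eqP: nz.
    rewrite linear_sum raddf_sum !coef_sum; apply: big1 => d _.
    by apply: contrapT => /eqP nzd; apply: all0; exists d.
  by apply: (homog_mon_mem k_gt0 JM (fP _ _ (cP d))) nzd; exists (c d).
have [b0 b0P] : exists b, J (y ^+ b).
  have nz : (f m0 : {poly {poly C}})`_0 != 0.
    apply: contraNneq m0P => fm0; apply/eqP; apply: (qpolyXn_eqP k_gt0) => a ak.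
    rewrite coef_xXM // coef0; case: ifP => // ka.
    by have -> : (a - k.-1 = 0)%N by lia.
  exists (size (f m0 : {poly {poly C}})`_0).-1; rewrite -[y ^+ _]mul1r.
  by apply: (J_mon (f m0) 0%N); [exists m0 | rewrite -lead_coefE lead_coef_eq0].
have ex_b a : exists b, `[< J (x ^+ a * y ^+ b) >].
  by exists b0; apply/asboolP/JM.
pose beta a := ex_minn (ex_b a).
have betaJ a : J (x ^+ a * y ^+ beta a).
  by rewrite /beta; case: ex_minnP => b /asboolP.
have beta_min a b : J (x ^+ a * y ^+ b) -> (beta a <= b)%N.
  by move=> Jb; rewrite /beta; case: ex_minnP => b' _; apply; apply/asboolP.
have beta_mono a a' : (a <= a')%N -> (beta a' <= beta a)%N.
  move=> aa'; apply: beta_min; rewrite -(subnK aa') exprD -mulrA.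
  exact: JM.
(* Since i_0 = 0, the common factor y^B is divided out: J = y^B I, and the degree of y^B enters the
   twist. *)
pose B := beta k.-1.
have I_sorted : sorted leq [tuple (beta (k.-1 - q.+1) - B)%N | q < k.-1].
  apply/(sortedP 0%N) => q; rewrite size_tuple => qk.
  rewrite -(tnth_nth 0%N _ (Ordinal qk)) -(tnth_nth 0%N _ (Ordinal (ltnW qk))).
  by rewrite !tnth_mktuple /= leq_sub2r // beta_mono // leq_sub2l.
pose I := Idx I_sorted (B%:Z + s).
have iE q : (q < k)%N -> idx_i I q = (beta (k.-1 - q) - B)%N.
  case: q => [|q] qk; first by rewrite idx_i0 subn0 subnn.
  have qk' : (q < k.-1)%N by rewrite ltn_predRL.
  rewrite /idx_i -[nth _ _ _]/(nth 0%N (idx_t I) (Ordinal qk')) -tnth_nth.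
  by rewrite tnth_mktuple.
have B_le a : (a < k)%N -> (B <= beta a)%N by move=> ak; apply: beta_mono; lia.
exists I; apply: gr_iso_sym.
have g_ex (r : idealI C I) : exists m, f m = y ^+ B * (ideal_val r : R).
  case: r => r rG /=; move: r rG; apply: gen_ideal_ind.
    by exists 0; rewrite linear0 mulr0.
  move=> c _ u [q qk ->] Ju; rewrite mulrDr; apply: (JD) => //.
  rewrite mulrCA; apply: (JM); rewrite mulrCA -exprD iE // subnKC; last by apply: B_le; lia.
  exact: betaJ.
have [g gE] := choice g_ex.
have [|h hE] := @linear_pack R (idealI C I) M g.
  move=> a u v; apply: f_inj; rewrite fE !gE.
  have -> : ideal_val (a *: u + v) = a * (ideal_val u : R) + (ideal_val v : R) :> R by [].
  by rewrite mulrDr mulrCA.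
have fhE r : f (h r) = y ^+ B * (ideal_val r : R) by rewrite hE gE.
have h_inj : injective h.
  move=> u v /(congr1 f); rewrite !fhE => /(yRX_inj k_gt0) uv.
  exact: val_inj.
have h_surj m : exists r, h r = m.
  pose u : R := f m.
  (* J contains every monomial of u, so y^(beta a) divides the coefficient of x^a; [r] is u divided
     by y^B. *)
  pose v a := drop_poly (beta a) (u : {poly {poly C}})`_a.
  have vE a : (u : {poly {poly C}})`_a = v a * 'X^(beta a).
    apply/polyP => b; rewrite coefMXn coef_drop_poly; case: ltnP => ba.
      apply/eqP; apply: contraTT ba => nz; rewrite -leqNgt; apply: beta_min.
      by apply: (J_mon u) nz; exists m.
    by rewrite subnK.
  pose r : R := \sum_(a < k) cst (v a) * (x ^+ a * y ^+ (beta a - B)).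
  have rG : r \in gen_ideal (@idx_gens C k I).
    rewrite /r; elim/big_ind: _ => [||a _]; [exact: gen_ideal0 | exact: gen_idealD |].
    apply: gen_idealM; apply: mon_idx_ideal => //.
    have ak := ltn_ord a; rewrite iE; last by lia.
    by have -> : (k.-1 - (k.-1 - a) = a)%N by lia.
  exists (IdealMod rG); apply: f_inj; rewrite fhE /= -/u [RHS](qpoly_sumE k_gt0 u).
  rewrite /r mulr_sumr; apply: eq_bigr => a _.
  rewrite mulrCA [y ^+ B * _]mulrCA -exprD subnKC; last exact: B_le.
  by rewrite vE rmorphM mulrAC -mulrA yRX.
exists h; split.
  have [h' h'K] := choice h_surj; exists h' => // r.
  by apply: h_inj; rewrite h'K.
move=> d r; split=> [rP|/fP].
  apply: (homog_reflect k_gt0 fP f_inj); rewrite fhE.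
  have yBP : partR (- B%:Z) (y ^+ B : R).
    by have := @partR_mon C k 0 B; rewrite mul1r sub0r.
  have -> : d + s = - B%:Z + (d + (B%:Z + s)) by lia.
  exact: partRM.
rewrite fhE => /(partR_yX k_gt0); rewrite -addrA [s + _]addrC; exact.
Qed.

End Classification.

(** * The mutually inverse maps *)

Lemma to_plu_coords_inj (C : fieldType) k : injective (@to_plu_coords C k).
Proof.
move=> l l' E; apply: (@plu_coord_inj C k).
exact: (congr1 (fun p : plu_coords C k => sval p) E).
Qed.

Theorem theoremA (R : realType) (k : nat) (k_ge2 : (2 <= k)%N) :
  exists (I_rank1 : forall I : idx k, mcm_rank1 (idealI R[i] I))
         (f : iso_classes R[i] k -> plu_coords R[i] k)
         (g : plu_coords R[i] k -> iso_classes R[i] k),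
    [/\ forall I : idx k, f (iso_class (I_rank1 I)) = to_plu_coords R[i] (ell I),
        forall l : ksubset k,
          g (to_plu_coords R[i] l) = iso_class (I_rank1 (back l)),
        cancel f g
      & cancel g f].
Proof.
have k_gt0 : (0 < k)%N by exact: ltnW.
pose I_rank1 I := @mcm_rank1_idealI R[i] k I k_gt0.
have classP (c : iso_classes R[i] k) : exists I, c = iso_class (I_rank1 I).
  case: c => c [M MP cE]; have [I MI] := mcm_rank1_ideal k_gt0 MP.
  by exists I; rewrite -(iso_class_eq MP (I_rank1 I) MI); apply: eq_exist.
have coordP (p : plu_coords R[i] k) : exists l, p = to_plu_coords R[i] l.
  by case: p => p [l pE]; exists l; apply: eq_exist.
(* Both maps go through chosen representatives I and l. These are unique by [gr_iso_idealI] and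
   [to_plu_coords_inj], so the stated formulas hold for every I and l. *)
have [idx_of idx_ofE] := choice classP.
have [sub_of sub_ofE] := choice coordP.
have idx_ofK I : idx_of (iso_class (I_rank1 I)) = I.
  apply: (@gr_iso_idealI R[i] k k_gt0).
  exact: (iso_class_inj (esym (idx_ofE (iso_class (I_rank1 I))))).
have sub_ofK l : sub_of (to_plu_coords R[i] l) = l.
  exact: (@to_plu_coords_inj R[i] k _ _ (esym (sub_ofE (to_plu_coords R[i] l)))).
pose cls I := iso_class (I_rank1 I); pose crd l := to_plu_coords R[i] (k := k) l.
exists I_rank1, (fun c => crd (ell (idx_of c))), (fun p => cls (back (sub_of p))).
split=> [I|l|c|p].
- exact: (congr1 (fun J => crd (ell J)) (idx_ofK I)).
- exact: (congr1 (fun l' => cls (back l')) (sub_ofK l)).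
- apply: (etrans _ (esym (idx_ofE c))); apply: (congr1 cls).
  exact: (etrans (congr1 (@back k) (sub_ofK _)) (ellK k_gt0 _)).
- apply: (etrans _ (esym (sub_ofE p))); apply: (congr1 crd).
  exact: (etrans (congr1 (@ell k) (idx_ofK _)) (backK k_gt0 _)).
Qed.
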